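(* If $F\colon\mathrm{LC}_{\mathrm c}(\mathbb{R}^n)\to[0,\infty]$ is upper semicontinuous, log-concave, and monotone increasing, then $$F^*(f,\mathcal{Y})\le F^*(f_{\mathrm{rot}},\mathcal{Y})$$ for every $f=e^{-\psi}\in\mathrm{LC}_{\mathrm c}(\mathbb{R}^n)$ and every $\mathcal{Y}\subseteq\mathscr{Y}_\psi$. In particular, $F^*(f,\mathcal{Y})$ and $F^*(f_{\mathrm{rot}},\mathcal{Y})$ are well-defined.
   Context: $\mathrm{Conv}_{\mathrm c}(\mathbb{R}^n)$ is the set of convex functions $\psi\colon\mathbb{R}^n\to(-\infty,\infty]$ that are proper ($\psi\not\equiv\infty$), lower semicontinuous, and coercive ($\lim_{|x|\to\infty}\psi(x)=\infty$). $\mathrm{LC}_{\mathrm c}(\mathbb{R}^n)=\{f=e^{-\psi}:\psi\in\mathrm{Conv}_{\mathrm c}(\mathbb{R}^n)\}$ (with $e^{-\infty}=0$). Here $n\geq 1$. Asplund sum: $(f\star g)(x)=\sup_{y\in\mathbb{R}^n}f(y)g(x-y)$. Homothety: $(\lambda\cdot f)(x)=f(x/\lambda)^\lambda$ for $\lambda>0$. Convention: a functional $F$ ''with values in $[0,\infty]$'' never attains both values $0$ and $\infty$. $F$ is log-concave if $F(\lambda\cdot f\star(1-\lambda)\cdot g)\ge F(f)^\lambda F(g)^{1-\lambda}$ for all $f,g\in\mathrm{LC}_{\mathrm c}(\mathbb{R}^n)$, $\lambda\in(0,1)$. $F$ is monotone increasing if $F(f)\le F(g)$ whenever $f\le g$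 pointwise. Semicontinuity is with respect to hypo-convergence: $f_j$ hypo-converges to $f$ if for every $x\in\mathbb{R}^n$, $f(x)\ge\limsup_jf_j(x_j)$ for every $x_j\to x$, and $f(x)=\lim_jf_j(x_j)$ for some $x_j\to x$. Legendre--Fenchel transform: $\mathcal{L}\psi(x)=\sup_{y\in\mathbb{R}^n}(\langle x,y\rangle-\psi(y))$; $\mathrm{dom}(\varphi)=\{x:\varphi(x)<\infty\}$. $B_n$ is the closed Euclidean unit ball. $r(\psi)=\sup\{r\ge0: rB_n\subseteq\mathrm{dom}(\mathcal{L}\psi)\}\in(0,\infty]$, with $r(\psi)B_n=\mathbb{R}^n$ if $r(\psi)=\infty$. Generalized outer linearization: for $\psi\in\mathrm{Conv}_{\mathrm c}(\mathbb{R}^n)$ and $y\in\mathbb{R}^n$, $\ell_{\psi,y}(x)=\langle x,y\rangle+c$ with $c\in[-\infty,\infty)$ maximal such that $\ell_{\psi,y}\le\psi$ pointwise ($\ell_{\psi,y}\equiv-\infty$ if no real $c$ works). For nonempty $Y\subseteq\mathbb{R}^n$, $q_{\psi,Y}(x)=\sup_{y\in Y}\ell_{\psi,y}(x)$. $\mathscr{Y}_\psi=\{Y\subseteq\mathbb{R}^n:\exists\,Y_o\subseteq Y\text{ with }\mathrm{pos}(Y_o)=\mathbb{R}^n\text{ and }Y_o\subseteq\mathrm{int}(r(\psi)B_n)\}$, where $\mathrm{pos}$ denotes the positive hull. For $g=e^{-\varphi}\in\mathrm{LC}_{\mathrm c}(\mathbb{R}^n)$, $F^*(g,\mathcal{Y})=\inf\{F(e^{-q_{\varphi\circ\vartheta^{-1},Y}}):\vartheta\in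 \mathrm{SO}(n),\,Y\in\mathcal{Y}\}$ for $n\ge2$; for $n=1$ the same with $\mathrm{O}(1)=\{\pm1\}$ in place of $\mathrm{SO}(1)$. Rotational epi-symmetrization: for $n\ge2$, $\psi_{\mathrm{rot}}$ is the unique function in $\mathrm{Conv}_{\mathrm c}(\mathbb{R}^n)$ with $\mathcal{L}\psi_{\mathrm{rot}}(x)=\int_{\mathrm{SO}(n)}\mathcal{L}\psi(\vartheta^{-1}x)\,\mathrm{d}\vartheta$ for all $x$ (Haar probability measure). For $n=1$, $\psi_{\mathrm{rot}}(x)=\tfrac12\,(\psi\,\square\,\psi^-)(2x)$, where $\psi^-(x)=\psi(-x)$ and $(\psi_1\,\square\,\psi_2)(x)=\inf_{y}(\psi_1(x-y)+\psi_2(y))$. For $f=e^{-\psi}$, $f_{\mathrm{rot}}=e^{-\psi_{\mathrm{rot}}}$. *)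

(* Defs.v *)
From HB Require Import structures.
From mathcomp Require Import all_boot all_order all_algebra.
From mathcomp Require Import all_classical all_reals all_analysis.

Set Implicit Arguments.
Unset Strict Implicit.
Unset Printing Implicit Defensive.

Import Order.TTheory GRing.Theory Num.Theory.
Import numFieldNormedType.Exports.

Local Open Scope classical_set_scope.
Local Open Scope ring_scope.

(* R^n is 'cV[R]_n.  Its library norm is the sup norm, which has the Euclidean
   topology; metric notions below use [enorm] instead. *)
Definition dotv (R : realType) (n : nat) (x y : 'cV[R]_n) : R :=
  \sum_(i < n) x i 0 * y i 0.

Definition enorm (R : realType) (n : nat) (x : 'cV[R]_n) : R :=
  Num.sqrt (dotv x x).

Local Open Scope ereal_scope.

Section Functions.
Variables (R : realType) (n : nat).
Local Notation V := 'cV[R]_n.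
Implicit Types (psi phi : V -> \bar R) (f g : V -> \bar R).

(* Only used for functions that avoid -oo, so that the sum on the right is
   never +oo + -oo. *)
Definition convex_ereal psi : Prop :=
  forall (x y : V) (t : R), (0 < t < 1)%R ->
    psi (t *: x + (1 - t) *: y)%R <= t%:E * psi x + (1 - t)%:E * psi y.

Definition coercive psi : Prop :=
  forall A : R, exists M : R, forall x : V, (M <= enorm x)%R -> A%:E <= psi x.

Record Conv_c psi : Prop := {
  Conv_c_ninfty : forall x, psi x != -oo;
  Conv_c_proper : exists x, psi x != +oo;
  Conv_c_convex : convex_ereal psi;
  Conv_c_lsc : lower_semicontinuous psi;
  Conv_c_coercive : coercive psi }.

Definition exp_neg psi : V -> \bar R := fun x => expeR (- psi x).

(* Inverse of [exp_neg]; note lne 0 = -oo. *)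
Definition neg_log f : V -> \bar R := fun x => - lne (f x).

(* Members of LC_c take values in [0, +oo[; the codomain is \bar R so that
   suprema and limits are those of the extended reals. *)
Definition LC_c f : Prop := exists2 psi, Conv_c psi & f = exp_neg psi.

Definition asplund f g : V -> \bar R :=
  fun x => ereal_sup [set f y * g (x - y)%R | y in [set: V]].

Definition homothety (l : R) f : V -> \bar R :=
  fun x => (f (l^-1 *: x)%R `^ l)%E.

Definition hypo_cvg (f_ : nat -> V -> \bar R) f : Prop :=
  forall x : V,
    (forall x_ : nat -> V, x_ j @[j --> \oo] --> x ->
       limn_esup (fun j => f_ j (x_ j)) <= f x) /\
    (exists2 x_ : nat -> V, x_ j @[j --> \oo] --> x &
       f_ j (x_ j) @[j --> \oo] --> f x).

(* Functionals on LC_c are given on all functions; nothing is ever assumed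
   about their values outside of LC_c. *)
Definition nonneg_valued (F : (V -> \bar R) -> \bar R) : Prop :=
  (forall f, LC_c f -> 0 <= F f) /\
  ~ ((exists2 f, LC_c f & F f = 0) /\ (exists2 g, LC_c g & F g = +oo)).

Definition log_concave (F : (V -> \bar R) -> \bar R) : Prop :=
  forall f g (l : R), LC_c f -> LC_c g -> (0 < l < 1)%R ->
    (F f `^ l * F g `^ (1 - l) <=
       F (asplund (homothety l f) (homothety (1 - l) g)))%E.

Definition monotone_increasing (F : (V -> \bar R) -> \bar R) : Prop :=
  forall f g, LC_c f -> LC_c g -> (forall x, f x <= g x) -> F f <= F g.

Definition hypo_usc (F : (V -> \bar R) -> \bar R) : Prop :=
  forall (f_ : nat -> V -> \bar R) f,
    (forall j, LC_c (f_ j)) -> LC_c f -> hypo_cvg f_ f ->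
    limn_esup (fun j => F (f_ j)) <= F f.

Definition legendre psi : V -> \bar R :=
  fun x => ereal_sup [set (dotv x y)%:E - psi y | y in [set: V]].

Definition edom phi : set V := [set x | phi x < +oo].

Definition radius psi : \bar R :=
  ereal_sup [set r%:E | r in
    [set r : R | (0 <= r)%R /\ [set x : V | (enorm x <= r)%R] `<=` edom (legendre psi)]].

(* r(psi) B_n, which is the whole space when r(psi) = +oo. *)
Definition radius_ball psi : set V := [set x | (enorm x)%:E <= radius psi].

(* The maximal c; the supremum belongs to the set when psi is proper, and it is
   -oo when no real c is admissible. *)
Definition lin_const psi (y : V) : \bar R :=
  ereal_sup [set c | c < +oo /\ forall x, (dotv x y)%:E + c <= psi x].

Definition lin psi (y : V) : V -> \bar R :=
  fun x => (dotv x y)%:E + lin_const psi y.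

Definition outer_lin psi (Y : set V) : V -> \bar R :=
  fun x => ereal_sup [set lin psi y x | y in Y].

Definition pos_hull (A : set V) : set V :=
  [set x | exists (k : nat) (a : 'I_k -> V) (l : 'I_k -> R),
     [/\ forall i, A (a i), forall i, (0 <= l i)%R &
         x = (\sum_(i < k) l i *: a i)%R]].

Definition admissible psi : set (set V) :=
  [set Y | exists Yo : set V,
     [/\ Yo `<=` Y, pos_hull Yo = [set: V] & Yo `<=` interior (radius_ball psi)]].

Definition inf_conv psi phi : V -> \bar R :=
  fun x => ereal_inf [set psi (x - y)%R + phi y | y in [set: V]].

End Functions.

Section Rotations.
Variables (R : realType) (n : nat).
Local Notation V := 'cV[R]_n.
Implicit Types (psi : V -> \bar R) (f : V -> \bar R).

Definition orthogonal_group : set 'M[R]_n :=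
  [set t | (t^T *m t)%R = 1%:M%R].

Definition rotation_group : set 'M[R]_n :=
  [set t | orthogonal_group t /\ (\det t)%R = 1%R].

(* SO(n) for n >= 2, and O(1) for n = 1. *)
Definition sym_group : set 'M[R]_n :=
  if n == 1%N then orthogonal_group else rotation_group.

Definition rotate (t : 'M[R]_n) psi : V -> \bar R :=
  fun x => psi (invmx t *m x)%R.

(* Square matrices with their Borel sigma-algebra. *)
Definition borel_mx : measurableType _ := g_sigma_algebraType (@open 'M[R]_n).

(* Haar probability measure of SO(n), as a Borel measure on all square
   matrices that is carried by SO(n). *)
Definition is_haar (mu : probability borel_mx R) : Prop :=
  mu rotation_group = 1 /\
  forall (t : 'M[R]_n) (A : set borel_mx), rotation_group t -> measurable A ->
    mu [set s : borel_mx | A (t *m (s : 'M[R]_n))%R] = mu A.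

(* The second branch picks the function of Conv_c that is characterized by its
   Legendre transform; the default value +oo of [xget] is irrelevant. *)
Definition rot_sym (mu : probability borel_mx R) psi : V -> \bar R :=
  if n == 1%N then
    fun x => (2^-1)%:E * inf_conv psi (fun y => psi (- y)%R) (2 *: x)%R
  else
    xget (fun=> +oo)
      [set phi : V -> \bar R | Conv_c phi /\
         forall x, legendre phi x =
           \int[mu]_(t in rotation_group) legendre psi (invmx (t : 'M[R]_n) *m x)%R].

(* The arguments of F in the infimum defining F^*(f, YY). *)
Definition sym_linearizations f (YY : set (set V)) : set (V -> \bar R) :=
  [set exp_neg (outer_lin (rotate t (neg_log f)) Y) | t in sym_group & Y in YY].

Definition Fstar (F : (V -> \bar R) -> \bar R) f (YY : set (set V)) : \bar R :=
  ereal_inf [set F h | h in sym_linearizations f YY].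

(* F^*(f, YY) makes sense for a functional F that is defined on LC_c only. *)
Definition Fstar_well_defined f (YY : set (set V)) : Prop :=
  LC_c f /\ forall h, sym_linearizations f YY h -> LC_c h.

End Rotations.

(* Main.v *)
Require Import Defs.
From HB Require Import structures.
From mathcomp Require Import all_boot all_order all_algebra.
From mathcomp Require Import all_classical all_reals all_analysis.
From mathcomp Require Import measurable_realfun ring lra.

Set Implicit Arguments.
Unset Strict Implicit.
Unset Printing Implicit Defensive.

Import Order.TTheory GRing.Theory Num.Theory.
Import numFieldNormedType.Exports.

Local Open Scope classical_set_scope.
Local Open Scope ring_scope.

(** The problem is transported to the conjugate h of psi. The affine function of
    slope y in the outer linearization of psi rotated by t has offset
    h(t^-1 y), so that this linearization is the supremum over y in Y of
    <x, y> - h(t^-1 y), while the symmetrized function has conjugate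
    g(y) = integral of h(s^-1 y) over the rotations s. Everything is thus about
    suprema q_v(x) = sup_i (<x, y_i> - v_i) of affine functions with fixed slopes
    and varying offsets v ([env]), and the theorem says that averaging the
    offsets over rotations does not push F(exp(-q_v)) below a level c that all
    the rotated copies reach, where c is the value of F^* at exp(-psi).

    For finitely many slopes this is Jensen's inequality in a weak form. The set of
    offsets v with c <= F(exp(-q_v)) is convex, because the infimal convolution
    of l.q_v and (1-l).q_w dominates q_(l v + (1-l) w), so that log-concavity and
    monotonicity apply ([superlevel_env_mean]); it is closed, by upper
    semicontinuity ([closed_superlevel_offsets]). A closed convex set contains
    the mean of every integrable vector with values in it
    ([closed_convex_mean]): integrate the inequality that characterizes the point
    of the set nearest to the mean. The vector at hand is
    s |-> (h(s^-1 t^-1 y_i))_i, whose values are offsets of linearizations of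
    psi rotated by t s; since t s is again a rotation, F is at least c at each of them.

    A general family Y is reduced to finite ones by upper semicontinuity: countably
    many affine pieces already generate the supremum, and q_v is the increasing
    limit of its finite subfamilies ([superlevel_of_finite]). Passing to a
    subfamily enlarges exp(-q_v), hence F by monotonicity.

    That the symmetrized function exists and lies in Conv_c is part of the claim. Its
    conjugate g is convex and, by Fatou's lemma, lower semicontinuous, and it
    is bounded near 0 because psi grows at least linearly; the conjugate of g is then
    in Conv_c, and g is its own biconjugate ([fenchel_moreau]). Admissibility of
    Y provides positively spanning slopes in the interior of the ball of radius
    r(psi), where h is bounded on spheres, so that g is finite there too and all
    linearizations are coercive. In dimension 1 the average is the mean of h(y)
    and h(-y), and a single use of [superlevel_env_mean] suffices. *)

(** * Euclidean geometry of column vectors *)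

Lemma continuous_sumr (R : numFieldType) (T : topologicalType) (I : Type)
    (r : seq I) (f : I -> T -> R) :
  (forall i, continuous (f i)) -> continuous (fun x => \sum_(i <- r) f i x).
Proof.
move=> cf x; elim: r => [|i r ih].
  by under eq_fun do rewrite big_nil; exact: cvg_cst.
by under eq_fun do rewrite big_cons; apply: cvgD; [exact: cf|exact: ih].
Qed.

Section EuclideanSpace.
Variables (R : realType) (n : nat).
Local Notation V := 'cV[R]_n.
Implicit Types (x y z : V) (a : R).

Lemma dotvC x y : dotv x y = dotv y x.
Proof. by apply: eq_bigr => i _; rewrite mulrC. Qed.

Lemma dotvDl x y z : dotv (x + y) z = dotv x z + dotv y z.
Proof. by rewrite -big_split; apply: eq_bigr => i _; rewrite mxE mulrDl. Qed.

Lemma dotvZl a x y : dotv (a *: x) y = a * dotv x y.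
Proof. by rewrite mulr_sumr; apply: eq_bigr => i _; rewrite mxE mulrA. Qed.

Lemma dotvNl x y : dotv (- x) y = - dotv x y.
Proof. by rewrite -scaleN1r dotvZl mulN1r. Qed.

Lemma dotvDr x y z : dotv x (y + z) = dotv x y + dotv x z.
Proof. by rewrite dotvC dotvDl !(dotvC x). Qed.

Lemma dotvZr a x y : dotv x (a *: y) = a * dotv x y.
Proof. by rewrite dotvC dotvZl dotvC. Qed.

Lemma dotvNr x y : dotv x (- y) = - dotv x y.
Proof. by rewrite dotvC dotvNl dotvC. Qed.

Lemma dotv0l x : dotv 0 x = 0.
Proof. by rewrite -(scale0r 0) dotvZl mul0r. Qed.

Lemma dotv0r x : dotv x 0 = 0.
Proof. by rewrite dotvC dotv0l. Qed.

Lemma dotv_sumr (I : Type) (r : seq I) (P : pred I) (f : I -> V) x :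
  dotv x (\sum_(i <- r | P i) f i) = \sum_(i <- r | P i) dotv x (f i).
Proof.
elim/big_rec2 : _ => [|i a b _ <-]; first exact: dotv0r.
by rewrite dotvDr.
Qed.

Lemma dotv_sqrDZ x y a :
  dotv (x + a *: y) (x + a *: y) = dotv x x + 2 * a * dotv x y + a ^+ 2 * dotv y y.
Proof. rewrite dotvDl !dotvDr !dotvZl !dotvZr (dotvC y x); ring. Qed.

Lemma dotv_delta x i a : dotv x (a *: delta_mx i 0) = a * x i 0.
Proof.
rewrite dotvZr; congr (_ * _); rewrite /dotv (bigD1 i)//= mxE !eqxx mulr1.
by rewrite big1 ?addr0// => j ji; rewrite mxE (negbTE ji) mulr0.
Qed.

Lemma dotvv_ge0 x : 0 <= dotv x x.
Proof. by apply: sumr_ge0 => i _; rewrite -expr2 sqr_ge0. Qed.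

Lemma sqr_enorm x : enorm x ^+ 2 = dotv x x.
Proof. by rewrite sqr_sqrtr ?dotvv_ge0. Qed.

Lemma enorm_ge0 x : 0 <= enorm x.
Proof. exact: sqrtr_ge0. Qed.

Lemma enorm0 : enorm (0 : V) = 0.
Proof. by rewrite /enorm dotv0l sqrtr0. Qed.

Lemma normr_coord_enorm x i : `|x i 0| <= enorm x.
Proof.
rewrite -sqrtr_sqr ler_wsqrtr// /dotv (bigD1 i)//= -expr2 lerDl.
by apply: sumr_ge0 => j _; rewrite -expr2 sqr_ge0.
Qed.

Lemma enorm_eq0 x : enorm x = 0 -> x = 0.
Proof.
move=> x0; apply/matrixP => i j; rewrite (ord1 j) mxE; apply/eqP.
by rewrite -normr_le0 -x0 normr_coord_enorm.
Qed.

Lemma enormZ a x : enorm (a *: x) = `|a| * enorm x.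
Proof.
by rewrite /enorm dotvZl dotvZr mulrA -expr2 sqrtrM ?sqr_ge0// sqrtr_sqr.
Qed.

Lemma enormN x : enorm (- x) = enorm x.
Proof. by rewrite -scaleN1r enormZ normrN1 mul1r. Qed.

Lemma cauchy_schwarz x y : dotv x y <= enorm x * enorm y.
Proof.
have [/enorm_eq0 ->|x0] := eqVneq (enorm x) 0; first by rewrite dotv0l enorm0 mul0r.
have [/enorm_eq0 ->|y0] := eqVneq (enorm y) 0; first by rewrite dotv0r enorm0 mulr0.
have xy : 0 < enorm x * enorm y by rewrite mulr_gt0// lt_def enorm_ge0 ?x0 ?y0.
rewrite -(ler_pM2l xy).
have := dotvv_ge0 (enorm y *: x - enorm x *: y).
rewrite dotvDl !dotvDr !dotvNl !dotvNr !dotvZl !dotvZr -!sqr_enorm (dotvC y x).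
set p := enorm x; set q := enorm y; set d := dotv x y; nra.
Qed.

Lemma ler_enormD x y : enorm (x + y) <= enorm x + enorm y.
Proof.
rewrite -(@ler_pXn2r _ 2)// ?nnegrE ?addr_ge0 ?enorm_ge0//.
rewrite sqr_enorm dotvDl !dotvDr (dotvC y x) -!sqr_enorm.
have := cauchy_schwarz x y; lra.
Qed.

Lemma mx_norm_le_enorm x : `|x| <= enorm x.
Proof.
rewrite [leLHS]/Num.Def.normr /= mx_normrE; apply/bigmax_leP; split=> [|[i j] _ /=].
  exact: enorm_ge0.
by rewrite (ord1 j) normr_coord_enorm.
Qed.

Lemma normr_coord_le_mx_norm x i : `|x i 0| <= `|x|.
Proof.
rewrite [leRHS]/Num.Def.normr /= mx_normrE; apply/bigmax_geP; right => /=.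
by exists (i, 0).
Qed.

Lemma enorm_le_mx_norm x : enorm x <= n%:R * `|x|.
Proof.
have xge0 : 0 <= n%:R * `|x| by rewrite mulr_ge0.
rewrite -[leRHS]ger0_norm// -sqrtr_sqr ler_wsqrtr//.
apply: (@le_trans _ _ (\sum_(i < n) `|x| ^+ 2)).
  apply: ler_sum => i _; rewrite -expr2 -real_normK ?num_real//.
  by rewrite ler_pXn2r ?nnegrE// normr_coord_le_mx_norm.
rewrite sumr_const card_ord exprMn -[leLHS]mulr_natl ler_wpM2r ?sqr_ge0//.
by rewrite -natrX ler_nat; case: (n) => // k; rewrite expnS leq_pmulr// expn_gt0.
Qed.

Lemma continuous_dotvr y : continuous (fun x => dotv x y).
Proof.
apply: continuous_sumr => i x.
exact: (cvgMr_tmp (@coord_continuous R n 1 i 0 x)).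
Qed.

Lemma continuous_dotvv : continuous (fun x => dotv x x).
Proof.
apply: continuous_sumr => i x.
exact: (cvgM (@coord_continuous R n 1 i 0 x) (@coord_continuous R n 1 i 0 x)).
Qed.

Lemma continuous_sqr_dist x : continuous (fun y => enorm (x - y) ^+ 2).
Proof.
rewrite (_ : (fun _ => _) = (fun y => \sum_(i < n) (x i 0 - y i 0) * (x i 0 - y i 0))).
  apply: continuous_sumr => i y.
  have h := cvgB (cvg_cst (x i 0)) (@coord_continuous R n 1 i 0 y).
  exact: (cvgM (h _ _) (h _ _)).
by apply/funext => y; rewrite sqr_enorm; apply: eq_bigr => i _; rewrite !mxE.
Qed.

Lemma continuous_enorm : continuous (@enorm R n).
Proof.
move=> x; apply: continuous_comp; first exact: continuous_dotvv.
exact: sqrt_continuous.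
Qed.

(** The topology of column vectors comes from the sup norm; both norms are equivalent. *)
Lemma nbhs_enorm x e : 0 < e -> \forall y \near x, enorm (y - x) < e.
Proof.
move=> e0.
pose d := e / n.+1%:R.
have d0 : 0 < d by rewrite divr_gt0.
apply/nbhs_ballP; exists d => //= y.
rewrite -ball_normE /= distrC => yx; apply: le_lt_trans (enorm_le_mx_norm _) _.
apply: (@le_lt_trans _ _ (n.+1%:R * `|y - x|)).
  by rewrite ler_wpM2r// ler_nat.
by rewrite mulrC -ltr_pdivlMr.
Qed.

End EuclideanSpace.

Lemma continuous_trmx (R : realType) m n :
  continuous (@trmx R m n).
Proof.
move=> A /= s /nbhs_ballP[e e0 es]; apply/nbhs_ballP; exists e => //= B [_ AB].
by apply: es; split => // i j; rewrite !mxE; exact: AB.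
Qed.

(** * Minimizers of lower semicontinuous functions *)

Section Minimizers.
Variables (R : realType) (n : nat).
Local Notation V := 'cV[R]_n.

Lemma compact_enorm_ball (M : R) : compact [set x : V | enorm x <= M].
Proof.
set K := [set x : V | _].
have cK : closed K.
  apply: (@closed_comp _ _ (@enorm R n) [set r | r <= M]).
    by move=> x _; exact: continuous_enorm.
  exact: closed_le.
have -> : K = trmx @` ((@trmx R 1 n) @^-1` K).
  by rewrite eqEsubset; split=> [x Kx|_ [x Kx <-]//]; exists x^T; rewrite /= trmxK.
apply: continuous_compact.
  by apply: continuous_subspaceT => x; exact: continuous_trmx.
apply: bounded_closed_compact.
  exists M; split; first exact: num_real.
  move=> N MN x /= Kx; apply: le_trans (ltW MN); apply: le_trans Kx.
  apply: le_trans (mx_norm_le_enorm _).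
  rewrite [leLHS]/Num.Def.normr /= mx_normrE; apply/bigmax_leP; split=> // -[i j] _ /=.
  by have := normr_coord_le_mx_norm x^T j; rewrite mxE (ord1 i).
by apply: closed_comp => // x _; exact: continuous_trmx.
Qed.

Local Open Scope ereal_scope.

(** If no point of K were minimal, lower semicontinuity and compactness would give
    one real b above the infimum m that f exceeds on all of K. *)
Lemma lsc_compact_min (K : set V) (f : V -> \bar R) :
  compact K -> K !=set0 -> lower_semicontinuous f ->
  exists2 x, K x & forall y, K y -> f x <= f y.
Proof.
move=> /compact_near_coveringP cK [x0 Kx0] lf; apply: contrapT => nomin.
have worse x : K x -> exists2 z, K z & f z < f x.
  move=> Kx; apply: contrapT => h; apply: nomin; exists x => // y Ky.
  by rewrite leNgt; apply/negP => yx; apply: h; exists y.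
set m := ereal_inf (f @` K).
have /worse[z0 Kz0 z0x0] := Kx0.
have mlt x : K x -> exists2 b, b%:E < f x & m < b%:E.
  move=> /worse[z Kz zx].
  have /worse[w Kw wz] := Kz.
  have fzfin : f z \is a fin_num.
    by rewrite fin_real// (le_lt_trans (leNye (f w)) wz) (lt_le_trans zx (leey _)).
  exists (fine (f z)); rewrite fineK//; apply: le_lt_trans wz.
  by apply: ereal_inf_lbound; exists w.
have [b mb Kb] : exists2 b : R, m < b%:E & forall x, K x -> b%:E < f x.
  (* right neighbourhoods of m, in which a uniform lower bound of f is sought *)
  have := cK R [set B | exists2 b, m < b%:E & [set c | m < c%:E /\ (c <= b)%R] `<=` B]
    (fun c x => c%:E < f x).
  case.
  - split.
    + have [b _ mb] := mlt _ Kx0; exists b => //.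
    + move=> P Q [b mb bP] [c mc cQ]; exists (Num.min b c).
        by case: (leP b c).
      by move=> d [md]; rewrite le_min => /andP[db dc]; split; [exact: bP|exact: cQ].
    + by move=> P Q PQ [b mb bP]; exists b => // c /bP /PQ.
  - move=> x Kx; have [b bx mb] := mlt _ Kx; have [U nU Ub] := lf _ _ bx.
    exists (U, [set c | m < c%:E /\ (c <= b)%R]); first by split=> //; exists b.
    by move=> [y c] /= [/Ub by_ [_ cb]]; apply: le_lt_trans by_; rewrite lee_fin.
  - move=> b mb bP; exists b => // x Kx; exact: (bP b).
have : b%:E <= m by apply: le_ereal_inf_tmp => _ [x Kx <-]; exact/ltW/Kb.
by rewrite leNgt mb.
Qed.

Lemma lsc_coercive_min (f : V -> \bar R) :
  lower_semicontinuous f -> coercive f -> exists x, forall y, f x <= f y.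
Proof.
move=> lf cf; have [foo|/existsNP[x0 x0oo]] := pselect (forall x, f x = +oo).
  by exists 0%R => y; rewrite !foo.
have [A x0A] : exists A : R, f x0 < A%:E.
  case: (f x0) x0oo => [r| |] // _; last by exists 0%R; rewrite ltNyr.
  by exists (r + 1)%R; rewrite lte_fin ltrDl.
have [M MA] := cf A.
have x0M : (enorm x0 <= M)%R.
  by rewrite leNgt; apply/negP => /ltW/MA; rewrite leNgt x0A.
have [x _ xmin] := lsc_compact_min (@compact_enorm_ball M) (ex_intro _ x0 x0M) lf.
exists x => y; have [/xmin//|/ltW/MA yA] := leP (enorm y) M.
by apply: le_trans yA; apply: le_trans (ltW x0A); exact: xmin.
Qed.

End Minimizers.

(** * Extended real numbers *)

Section ExtendedReals.
Variable R : realType.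
Local Open Scope ereal_scope.

Lemma lte_split_add (a : R) (u v : \bar R) : u != -oo -> v != -oo ->
  a%:E < u + v -> exists b c : R, [/\ b%:E < u, c%:E < v & (a <= b + c)%R].
Proof.
case: u v => [u| |] [v| |]// _ _; rewrite ?lte_fin => auv.
- exists (u - (u + v - a) / 2)%R, (v - (u + v - a) / 2)%R.
  rewrite !lte_fin; split; lra.
- exists (u - 1)%R, (a - u + 1)%R; rewrite lte_fin ltry; split=> //; lra.
- exists (a - v + 1)%R, (v - 1)%R; rewrite lte_fin ltry; split=> //; lra.
- by exists a, 0%R; rewrite !ltry addr0.
Qed.

Lemma ereal_between (u v : \bar R) : u < v ->
  exists a : R, u < a%:E /\ a%:E < v.
Proof.
case: u v => [u| |] [v| |]//.
- by rewrite lte_fin => uv; exists ((u + v) / 2)%R; rewrite !lte_fin; split; lra.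
- by move=> _; exists (u + 1)%R; rewrite ltry lte_fin ltrDl.
- by move=> _; exists (v - 1)%R; rewrite ltNyr lte_fin gtrBl.
- by move=> _; exists 0%R; rewrite ltNyr ltry.
Qed.

Lemma scale_neqNy (l : R) (u : \bar R) : (0 < l)%R -> u != -oo -> l%:E * u != -oo.
Proof. by move=> l0; case: u => [r| |]// _; rewrite gt0_muley ?lte_fin. Qed.

Lemma le_geometric_mean (c u v : \bar R) (l : R) : (0 < l < 1)%R ->
  0 <= u -> 0 <= v -> c <= u -> c <= v -> c <= u `^ l * v `^ (1 - l).
Proof.
move=> /andP[l0 l1] u0 v0 cu cv; have l1' : (0 < 1 - l)%R by rewrite subr_gt0.
have [c0|c0] := leP c 0; first by apply: le_trans c0 _; rewrite mule_ge0// poweR_ge0.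
have -> : c = c `^ l * c `^ (1 - l).
  rewrite -poweRD; last by rewrite add_neq0_poweRD_def// addrC subrK oner_neq0.
  by rewrite addrC subrK poweRe1// ltW.
have mono (r : R) (w : \bar R) : (0 < r)%R -> 0 <= w -> c <= w -> c `^ r <= w `^ r.
  move=> r0 w0 cw; apply: gt0_ler_poweR => //; first exact: ltW.
    by rewrite in_itv/= leey ltW.
  by rewrite in_itv/= leey w0.
by apply: lee_pmul; rewrite ?poweR_ge0//; exact: mono.
Qed.

End ExtendedReals.

(** * Convex functions with extended real values *)

Section ExtendedConvexFunctions.
Variables (R : realType) (n : nat).
Local Notation V := 'cV[R]_n.
Local Open Scope ereal_scope.
Implicit Types (psi phi : V -> \bar R).

Lemma convex_ereal_le psi (x y : V) (t r s : R) : convex_ereal psi ->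
  (0 < t < 1)%R -> psi x <= r%:E -> psi y <= s%:E ->
  psi (t *: x + (1 - t) *: y)%R <= (t * r + (1 - t) * s)%:E.
Proof.
move=> cpsi t01 xr ys; apply: le_trans (cpsi x y t t01) _.
have /andP[t0 t1] := t01.
rewrite [leRHS]EFinD !EFinM leeD// lee_wpmul2l// lee_fin ?subr_ge0 ltW//.
Qed.

(** The inequality has content only where both values are real, as -oo is excluded. *)
Lemma convex_ereal_fin psi : (forall x, psi x != -oo) ->
  (forall (x y : V) (t r s : R), (0 < t < 1)%R -> psi x = r%:E -> psi y = s%:E ->
     psi (t *: x + (1 - t) *: y)%R <= (t * r + (1 - t) * s)%:E) ->
  convex_ereal psi.
Proof.
move=> psiN cpsi x y t t01; have /andP[t0 t1] := t01.
have t1' : (0 < 1 - t)%R by rewrite subr_gt0.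
have := psiN x; have := psiN y; case ey: (psi y) => [s| |]//; case ex: (psi x) => [r| |]// _ _.
- by rewrite -!EFinM -EFinD; exact: cpsi.
- by rewrite mulry gtr0_sg// mul1e addye ?leey// -EFinM.
- by rewrite mulry gtr0_sg// mul1e addey ?leey// -EFinM.
- by rewrite !gt0_muley ?lte_fin// addye// leey.
Qed.

Lemma lsc_comp (m : nat) (f : V -> \bar R) (g : 'cV[R]_m -> V) :
  lower_semicontinuous f -> continuous g -> lower_semicontinuous (f \o g).
Proof.
move=> lf cg x a /lf[U nU Ua]; exists (g @^-1` U); first exact: cg.
by move=> y /Ua.
Qed.

Lemma lsc_near psi x (a : R) : lower_semicontinuous psi -> a%:E < psi x ->
  \forall y \near x, a%:E < psi y.
Proof. by move=> lpsi /lpsi[U nU Ua]; apply: filterS nU. Qed.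

Lemma near_lsc psi : (forall x (a : R), a%:E < psi x -> \forall y \near x, a%:E < psi y) ->
  lower_semicontinuous psi.
Proof. by move=> h x a /h ax; exists [set y | a%:E < psi y]. Qed.

(** * Suprema of affine functions *)

(** The offset +oo stands for an absent affine function. Indexing by a type rather than
    by slopes lets finite families carry a vector of offsets. *)
Definition env (I : Type) (A : set I) (y : I -> V) (v : I -> \bar R) : V -> \bar R :=
  fun x => ereal_sup [set (dotv x (y i))%:E - v i | i in A].

Section Env.
Variables (I : Type) (A : set I) (y : I -> V).
Implicit Type v : I -> \bar R.

Lemma env_ub v x i : A i -> (dotv x (y i))%:E - v i <= env A y v x.
Proof. by move=> Ai; apply: ereal_sup_ubound; exists i. Qed.

Lemma env_le v x b : (forall i, A i -> (dotv x (y i))%:E - v i <= b) -> env A y v x <= b.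
Proof. by move=> h; apply: ge_ereal_sup => _ [i Ai <-]; exact: h. Qed.

Lemma env_lsc v : lower_semicontinuous (env A y v).
Proof.
move=> x a /ereal_sup_gt[_ [i Ai <-]] ai.
suff H : \forall z \near x, a%:E < (dotv z (y i))%:E - v i.
  by exists [set z | a%:E < (dotv z (y i))%:E - v i] => // z /lt_le_trans; apply; exact: env_ub.
case: (v i) ai => [r| |].
- rewrite -EFinB lte_fin ltrBrDr => ar.
  have : \forall z \near x, (a + r < dotv z (y i))%R.
    exact: (@continuous_dotvr R n (y i) x _ (lt_nbhsr ar)).
  by apply: filterS => z; rewrite -EFinB lte_fin ltrBrDr.
- by rewrite addeNy ltNge leNye.
- by move=> _; apply: filterE => z; rewrite ltry.
Qed.

Lemma env_neqNy v x i : A i -> v i < +oo -> env A y v x != -oo.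
Proof.
move=> Ai vi; rewrite -ltNye; apply: lt_le_trans (env_ub v x Ai).
by case: (v i) vi => [r| |]// _; rewrite -?EFinB ltNyr.
Qed.

Lemma env_convex v : (forall x, env A y v x != -oo) -> convex_ereal (env A y v).
Proof.
move=> vN; apply: convex_ereal_fin => // x z t r s /andP[t0 t1] xr zs.
apply: env_le => i Ai.
have := env_ub v x Ai; have := env_ub v z Ai; rewrite xr zs.
case: (v i) => [w| |]; [|by move=> _ _ /=; rewrite leNye|by []].
rewrite -!EFinB !lee_fin dotvDl !dotvZl => zs' xr'; nra.
Qed.

Lemma env_antitone v w x : (forall i, A i -> v i <= w i) -> env A y w x <= env A y v x.
Proof.
move=> vw; apply: env_le => i Ai; apply: le_trans (env_ub v x Ai).
by rewrite leeD2l// leeN2; exact: vw.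
Qed.

End Env.

(** * The Legendre transform *)

Lemma legendre_ub psi x y : (dotv x y)%:E - psi y <= legendre psi x.
Proof. exact: (@env_ub _ setT id psi x y Logic.I). Qed.

Lemma legendre_le psi x b : (forall y, (dotv x y)%:E - psi y <= b) -> legendre psi x <= b.
Proof. by move=> h; apply: env_le => i _; exact: h. Qed.

Lemma legendre_lsc psi : lower_semicontinuous (legendre psi).
Proof. exact: env_lsc. Qed.

Lemma legendre_neqNy psi x : (exists y, psi y != +oo) -> legendre psi x != -oo.
Proof. by move=> [y]; rewrite -ltey => yoo; exact: (@env_neqNy _ setT id psi x y Logic.I yoo). Qed.

Lemma legendre_convex psi : (exists y, psi y != +oo) -> convex_ereal (legendre psi).
Proof. by move=> h; apply: env_convex => x; exact: legendre_neqNy. Qed.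

(** * Growth of coercive convex functions and of their conjugates *)

Lemma Conv_c_fin_pt psi : Conv_c psi -> exists (x : V) (r : R), psi x = r%:E.
Proof.
move=> cpsi; have [x xoo] := Conv_c_proper cpsi; exists x.
by have := Conv_c_ninfty cpsi x; case: (psi x) xoo => // r; exists r.
Qed.

Lemma Conv_c_bounded_below psi : Conv_c psi -> exists d : R, forall x, d%:E <= psi x.
Proof.
move=> cpsi; have [x xmin] := lsc_coercive_min (Conv_c_lsc cpsi) (Conv_c_coercive cpsi).
have [x0 [r0 x0r0]] := Conv_c_fin_pt cpsi.
have := xmin x0; have := Conv_c_ninfty cpsi x; rewrite x0r0.
by case ex: (psi x) => [r| |]// _ _; exists r => y; rewrite -ex.
Qed.

(** A convex function that is larger by 1 on a sphere around x0 than at x0 grows at least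
    linearly outside of it, with slope the inverse of the radius. *)
Lemma Conv_c_growth psi : Conv_c psi ->
  exists c d : R, (0 < c)%R /\ forall x, (c * enorm x - d)%:E <= psi x.
Proof.
move=> cpsi; have [b psib] := Conv_c_bounded_below cpsi.
have [x0 [r0 x0r0]] := Conv_c_fin_pt cpsi.
have [M MA] := Conv_c_coercive cpsi (r0 + 1)%R.
pose M1 := (Num.max M 0 + enorm x0 + 1)%R.
have M10 : (0 < M1)%R.
  by rewrite ltr_wpDl// addr_ge0 ?enorm_ge0// le_max lexx orbT.
have far z : (M1 <= enorm (z - x0))%R -> (r0 + 1)%:E <= psi z.
  move=> Mz; apply: MA.
  have := ler_enormD z (- x0); rewrite enormN => h.
  have : (M <= Num.max M 0)%R by rewrite le_max lexx.
  rewrite /M1 in Mz; lra.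
exists M1^-1%R, (M1^-1 * enorm x0 + `|r0| + `|b| + 1)%R; split; first by rewrite invr_gt0.
move=> x.
have tri : (enorm x <= enorm (x - x0) + enorm x0)%R.
  by apply: le_trans (ler_enormD _ _); rewrite subrK.
have nr : (- `|r0| <= r0)%R by rewrite lerNl -normrN ler_norm.
have nb : (- `|b| <= b)%R by rewrite lerNl -normrN ler_norm.
have r0' := normr_ge0 r0.
have b0' := normr_ge0 b.
have M1' : (0 < M1^-1)%R by rewrite invr_gt0.
have [xM|xM] := leP (enorm (x - x0)) M1.
  apply: le_trans (psib x); rewrite lee_fin.
  have : (M1^-1 * enorm (x - x0) <= 1)%R by rewrite mulrC ler_pdivrMr// mul1r.
  nra.
set s := enorm (x - x0) in xM tri.
have s0 : (0 < s)%R by exact: lt_trans xM.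
pose t := (M1 / s)%R.
have t0 : (0 < t)%R by rewrite divr_gt0.
have t1 : (t < 1)%R by rewrite ltr_pdivrMr// mul1r.
case ex: (psi x) => [r| |]; [|exact: leey|by have := Conv_c_ninfty cpsi x; rewrite ex].
have := convex_ereal_le (x := x) (y := x0) (t := t) (r := r) (s := r0) (Conv_c_convex cpsi).
rewrite t0 t1 ex x0r0 !lexx => /(_ isT isT isT) h.
have zM : (M1 <= enorm (t *: x + (1 - t) *: x0 - x0))%R.
  have -> : (t *: x + (1 - t) *: x0 - x0 = t *: (x - x0))%R.
    by apply/matrixP => i j; rewrite !mxE; ring.
  by rewrite enormZ gtr0_norm// -/s /t divfK// gt_eqF.
have := le_trans (far _ zM) h; rewrite lee_fin => h2.
rewrite lee_fin.
(* convexity on [x0, x] gives 1 <= t (r - r0) with t = M1 / s *)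
have : (s / M1 <= r - r0)%R.
  rewrite ler_pdivrMr// -(ler_pM2l (x := t))//.
  rewrite {1}/t divfK ?gt_eqF// mulrA; nra.
have : (M1^-1 * enorm x <= M1^-1 * (s + enorm x0))%R by rewrite ler_pM2l.
rewrite (mulrC s); nra.
Qed.

Lemma legendre_lower psi : Conv_c psi ->
  exists C D : R, (0 <= C)%R /\ forall y, (- (C * enorm y) - D)%:E <= legendre psi y.
Proof.
move=> cpsi; have [x0 [r0 x0r0]] := Conv_c_fin_pt cpsi.
exists (enorm x0), r0; split=> [|y]; first exact: enorm_ge0.
apply: le_trans (legendre_ub psi y x0); rewrite x0r0 -EFinB lee_fin lerD2r.
by rewrite lerNl -dotvNr mulrC -(enormN x0) cauchy_schwarz.
Qed.

(** This is the conjugate form of linear growth. *)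
Lemma legendre_near0 psi : Conv_c psi ->
  exists c d : R, (0 < c)%R /\ forall y, (enorm y <= c)%R -> legendre psi y <= d%:E.
Proof.
move=> /Conv_c_growth[c [d [c0 cd]]]; exists c, d; split=> // y yc.
apply: legendre_le => x; apply: (@le_trans _ _ ((dotv y x)%:E - (c * enorm x - d)%:E)).
  by rewrite leeD2l// leeN2.
rewrite -EFinB lee_fin; have := cauchy_schwarz y x; have := enorm_ge0 x; nra.
Qed.

(** Near x the function is bounded by convexity between x / t, where it is finite, and a
    small ball around 0, where it is at most d; compactness makes the bound uniform. *)
Lemma convex_bounded_on_ball (h : V -> \bar R) (c d s r : R) :
  convex_ereal h -> (forall y, h y != -oo) -> (0 < c)%R ->
  (forall y, (enorm y <= c)%R -> h y <= d%:E) ->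
  (0 <= s < r)%R -> (forall y, (enorm y <= r)%R -> h y < +oo) ->
  exists B : R, forall y, (enorm y <= s)%R -> h y <= B%:E.
Proof.
move=> ch hN c0 hc /andP[s0 sr] hr.
pose t := ((s + r) / 2 / r)%R.
have r0 : (0 < r)%R by lra.
have t0 : (0 < t)%R by rewrite !divr_gt0//; lra.
have t1 : (t < 1)%R by rewrite ltr_pdivrMr// mul1r; lra.
have /compact_near_coveringP cK := @compact_enorm_ball R n s.
have := cK R +oo%R (fun B y => h y <= B%:E) _.
case.
  move=> x /= xs.
  have hx : h (t^-1 *: x)%R < +oo.
    apply: hr; rewrite enormZ gtr0_norm ?invr_gt0// mulrC ler_pdivrMr// /t.
    by rewrite mulrC divfK ?gt_eqF//; lra.
  have [b hb] : exists b : R, h (t^-1 *: x)%R <= b%:E.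
    have := hN (t^-1 *: x)%R; case: (h _) hx => // b _ _; by exists b.
  have near_x : \forall y \near x, (enorm (y - x) < (1 - t) * c)%R.
    by apply: nbhs_enorm; rewrite mulr_gt0// subr_gt0.
  exists ([set y | (enorm (y - x) < (1 - t) * c)%R], [set B | (t * b + (1 - t) * d <= B)%R]).
    by split=> //; apply: nbhs_pinfty_ge; exact: num_real.
  move=> [y B] /= [yx tB].
  have -> : y = (t *: (t^-1 *: x) + (1 - t) *: ((1 - t)^-1 *: (y - x)))%R.
    by rewrite !scalerA !mulfV ?scale1r ?subr_eq0 ?gt_eqF// addrC subrK.
  apply: (@le_trans _ _ (t * b + (1 - t) * d)%:E); last by rewrite lee_fin.
  apply: convex_ereal_le => //; first by rewrite t0.
  apply: hc; rewrite enormZ gtr0_norm ?invr_gt0 ?subr_gt0// mulrC ler_pdivrMr ?subr_gt0//.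
  by rewrite mulrC ltW.
move=> M [_ hM]; exists (M + 1)%R => y ys; apply: (hM (M + 1)%R) => //.
by rewrite ltrDl.
Qed.

(** A point interior to the ball of radius r(psi) has norm less than r(psi), as it can be
    moved outwards. The bound on the whole sphere is what survives rotations. *)
Lemma legendre_bounded_in_radius psi y : Conv_c psi -> interior (Defs.radius_ball psi) y ->
  exists B : R, forall z, enorm z = enorm y -> legendre psi z <= B%:E.
Proof.
move=> cpsi yint; have [c [d [c0 hc]]] := legendre_near0 cpsi.
have [/enorm_eq0 ->|y0] := eqVneq (enorm y) 0%R.
  by exists d => z; rewrite enorm0 => z0; apply: hc; rewrite z0 ltW.
have yr : (enorm y)%:E < Defs.radius psi.
  have [e e0 ye] : exists2 e : R, (0 < e)%R & Defs.radius_ball psi ((1 + e) *: y).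
    have ct : {for 0%R, continuous (fun e : R => (1 + e) *: y)}.
      by apply: cvgZr_tmp; apply: cvgD; [exact: cvg_cst|exact: cvg_id].
    have : \forall e \near 0%R, Defs.radius_ball psi ((1 + e) *: y).
      by apply: ct; rewrite addr0 scale1r.
    move=> /nbhs_ballP[e /= e0 he]; exists (e / 2)%R; first by rewrite divr_gt0.
    apply: he; rewrite -ball_normE /= sub0r normrN gtr0_norm ?divr_gt0//.
    by rewrite ltr_pdivrMr// ltr_pMr// ltr1n.
  apply: lt_le_trans ye; rewrite lte_fin enormZ gtr0_norm ?addr_gt0//.
  by rewrite ltr_pMl ?ltrDl// lt_def y0 enorm_ge0.
have [_ [r [r0 rdom] <-]] := ereal_sup_gt yr; rewrite lte_fin => yr'.
have [B hB] : exists B : R, forall z, (enorm z <= enorm y)%R -> legendre psi z <= B%:E.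
  apply: (convex_bounded_on_ball (c := c) (d := d) (r := r)) => //.
  - exact: legendre_convex (Conv_c_proper cpsi).
  - by move=> z; exact: legendre_neqNy (Conv_c_proper cpsi).
  - by rewrite enorm_ge0.
by exists B => z zy; apply: hB; rewrite zy.
Qed.

End ExtendedConvexFunctions.

(** * Infimal convolution *)

Section InfConvolution.
Variables (R : realType) (n : nat).
Local Notation V := 'cV[R]_n.
Local Open Scope ereal_scope.
Implicit Types (psi phi : V -> \bar R).

(** The epigraph of psi scaled by l; this is the convex counterpart of the homothety of a
    log-concave function. *)
Definition epi_scale (l : R) psi : V -> \bar R := fun x => l%:E * psi (l^-1 *: x)%R.

Lemma lsc_scale (l : R) psi : (0 < l)%R -> lower_semicontinuous psi ->
  lower_semicontinuous (fun x => l%:E * psi x).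
Proof.
move=> l0 lpsi x a; rewrite muleC -lte_pdivrMr// -EFinM => /lpsi[U nU Ua].
by exists U => // y /Ua; rewrite EFinM lte_pdivrMr// muleC.
Qed.

Lemma Conv_c_epi_scale (l : R) psi : (0 < l)%R -> Conv_c psi -> Conv_c (epi_scale l psi).
Proof.
move=> l0 cpsi; have psiN := Conv_c_ninfty cpsi; split.
- by move=> x; exact: scale_neqNy.
- have [x [r xr]] := Conv_c_fin_pt cpsi; exists (l *: x)%R.
  by rewrite /epi_scale scalerA mulVf ?(gt_eqF l0)// scale1r xr.
- apply: convex_ereal_fin => [x|x y t r s t01]; first exact: scale_neqNy.
  rewrite /epi_scale => xr ys.
  have fin z (w : R) : l%:E * psi (l^-1 *: z)%R = w%:E -> psi (l^-1 *: z)%R <= (l^-1 * w)%:E.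
    have := psiN (l^-1 *: z)%R; case: (psi _) => [u| |]//.
      by move=> _ [<-]; rewrite mulKf ?gt_eqF.
    by rewrite gt0_muley ?lte_fin.
  rewrite scalerDr !scalerA !(mulrC l^-1%R) -!scalerA.
  have := convex_ereal_le (Conv_c_convex cpsi) t01 (fin _ _ xr) (fin _ _ ys).
  move=> /(lee_wpmul2l (ltW l0 : 0 <= l%:E)) /le_trans; apply.
  rewrite -EFinM lee_fin le_eqVlt; apply/orP; left; apply/eqP.
  by field; rewrite gt_eqF.
- apply: lsc_scale => //.
  apply: (@lsc_comp R n n psi (fun x => (l^-1 *: x)%R)).
    exact: Conv_c_lsc.
  exact: scaler_continuous.
- move=> A; have [M MA] := Conv_c_coercive cpsi (l^-1 * A)%R; exists (l * M)%R => x Mx.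
  have /MA : (M <= enorm (l^-1 *: x))%R.
    by rewrite enormZ gtr0_norm ?invr_gt0// ler_pdivlMl.
  move=> /(lee_wpmul2l (ltW l0 : 0 <= l%:E)); apply: le_trans.
  by rewrite -EFinM mulVKf ?gt_eqF.
Qed.

Section InfConv.
Variables (psi phi : V -> \bar R).
Hypotheses (cpsi : Conv_c psi) (cphi : Conv_c phi).

Let summand (x y : V) : \bar R := psi (x - y)%R + phi y.

Let summand_growth : exists c d : R, (0 < c)%R /\
  forall x y, (c * enorm (x - y) + c * enorm y - d)%:E <= summand x y.
Proof.
have [c1 [d1 [c10 h1]]] := Conv_c_growth cpsi.
have [c2 [d2 [c20 h2]]] := Conv_c_growth cphi.
exists (Num.min c1 c2), (d1 + d2)%R; split; first by rewrite lt_min c10.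
move=> x y; apply: le_trans (leeD (h1 (x - y)%R) (h2 y)).
rewrite -EFinD lee_fin.
have m1 : (Num.min c1 c2 <= c1)%R by rewrite ge_min lexx.
have m2 : (Num.min c1 c2 <= c2)%R by rewrite ge_min lexx orbT.
have := ler_wpM2r (enorm_ge0 (x - y)) m1.
have := ler_wpM2r (enorm_ge0 y) m2.
lra.
Qed.

Let summand_lsc x y a : a%:E < summand x y ->
  \forall p \near (x, y), a%:E < summand p.1 p.2.
Proof.
move=> /lte_split_add [||b [c [bx cy abc]]]; try exact: Conv_c_ninfty.
have n1 : \forall p \near (x, y), b%:E < psi (p.1 - p.2)%R.
  have ct : {for (x, y), continuous (fun p : V * V => p.1 - p.2)%R}.
    by apply: cvgB; [exact: cvg_fst|exact: cvg_snd].
  exact: ct _ (lsc_near (Conv_c_lsc cpsi) bx).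
have n2 : \forall p \near (x, y), c%:E < phi p.2.
  exact: (@cvg_snd _ _ (nbhs x) (nbhs y)) _ (lsc_near (Conv_c_lsc cphi) cy).
apply: filterS2 n1 n2 => p pb pc; apply: le_lt_trans (lteD pb pc).
by rewrite -EFinD lee_fin.
Qed.

(** Both summands grow linearly, so that the infimum over y is that of a coercive
    function. *)
Lemma inf_conv_attained x : exists y, inf_conv psi phi x = psi (x - y)%R + phi y.
Proof.
have [c [d [c0 hcd]]] := summand_growth.
have [y ymin] : exists y, forall z, summand x y <= summand x z.
  apply: lsc_coercive_min.
    move=> y a /summand_lsc [[U W] [/= nU nW] UW]; exists W => // z Wz.
    by apply: (UW (x, z)); split => //; exact: nbhs_singleton.
  move=> A; exists (c^-1 * (A + d))%R => y; rewrite ler_pdivrMl// => Ay.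
  apply: le_trans (hcd x y); rewrite lee_fin.
  have := mulr_ge0 (ltW c0) (enorm_ge0 (x - y)); lra.
exists y; apply/eqP; rewrite eq_le; apply/andP; split.
  by apply: ereal_inf_lbound; exists y.
by apply: le_ereal_inf_tmp => _ [z _ <-]; exact: ymin.
Qed.

Lemma Conv_c_inf_conv : Conv_c (inf_conv psi phi).
Proof.
have [c [d [c0 hcd]]] := summand_growth.
have lower x : (c * enorm x - d)%:E <= inf_conv psi phi x.
  apply: le_ereal_inf_tmp => _ [y _ <-]; apply: le_trans (hcd x y).
  rewrite lee_fin lerD2r -mulrDr ler_pM2l//.
  by apply: le_trans (ler_enormD _ _); rewrite subrK.
have infN x : inf_conv psi phi x != -oo.
  by rewrite -ltNye; apply: lt_le_trans (lower x); rewrite ltNyr.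
split=> //.
- have [x1 [r1 e1]] := Conv_c_fin_pt cpsi; have [x2 [r2 e2]] := Conv_c_fin_pt cphi.
  exists (x1 + x2)%R; rewrite -ltey.
  apply: (@le_lt_trans _ _ (r1 + r2)%:E); last by rewrite ltry.
  by apply: ereal_inf_lbound; exists x2 => //; rewrite addrK e1 e2.
- apply: convex_ereal_fin => // x1 x2 t r1 r2 t01.
  have [y1 ->] := inf_conv_attained x1; have [y2 ->] := inf_conv_attained x2.
  have := Conv_c_ninfty cpsi (x1 - y1)%R; have := Conv_c_ninfty cphi y1.
  have := Conv_c_ninfty cpsi (x2 - y2)%R; have := Conv_c_ninfty cphi y2.
  case ep2: (phi y2) => [p2| |]//; case eq2: (psi (x2 - y2)%R) => [q2| |]//.
  case ep1: (phi y1) => [p1| |]//; case eq1: (psi (x1 - y1)%R) => [q1| |]//.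
  move=> _ _ _ _ [<-] [<-].
  apply: (@le_trans _ _ (summand (t *: x1 + (1 - t) *: x2) (t *: y1 + (1 - t) *: y2))%R).
    by apply: ereal_inf_lbound; exists (t *: y1 + (1 - t) *: y2)%R.
  rewrite /summand.
  have -> : (t *: x1 + (1 - t) *: x2 - (t *: y1 + (1 - t) *: y2) =
             t *: (x1 - y1) + (1 - t) *: (x2 - y2))%R.
    by apply/matrixP => i j; rewrite !mxE; ring.
  have -> : (t * (q1 + p1) + (1 - t) * (q2 + p2) =
             (t * q1 + (1 - t) * q2) + (t * p1 + (1 - t) * p2))%R by ring.
  rewrite EFinD; apply: leeD; apply: convex_ereal_le => //.
  - exact: Conv_c_convex.
  - by rewrite eq1.
  - by rewrite eq2.
  - exact: Conv_c_convex.
  - by rewrite ep1.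
  - by rewrite ep2.
- apply: near_lsc => x a ax.
  have [b [ab bx]] := ereal_between ax.
  (* outside of this ball, the linear growth alone keeps the summand above b *)
  have /compact_near_coveringP cK := @compact_enorm_ball R n (c^-1 * (b + d)).
  have near_x : \forall z \near x, [set y | (enorm y <= c^-1 * (b + d))%R] `<=`
      (fun y => b%:E < summand z y).
    apply: (cK V (nbhs x) (fun z y => b%:E < summand z y)) => y _.
    have by_ : b%:E < summand x y.
      by apply: lt_le_trans bx _; apply: ereal_inf_lbound; exists y.
    have [[U W] [/= nU nW] UW] := summand_lsc by_.
    by exists (W, U) => // -[z w] [/= Wz Uw]; exact: (UW (w, z)).
  apply: filterS near_x => z zK.
  apply: (lt_le_trans ab).
  apply: le_ereal_inf_tmp => _ [y _ <-].
  have [yK|yK] := leP (enorm y) (c^-1 * (b + d))%R; first exact/ltW/zK.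
  apply: le_trans (hcd z y); rewrite lee_fin.
  move: yK; rewrite ltr_pdivrMl// => yK.
  have := mulr_ge0 (ltW c0) (enorm_ge0 (z - y)); lra.
- move=> A; exists (c^-1 * (A + d))%R => x; rewrite ler_pdivrMl// => Ax.
  by apply: le_trans (lower x); rewrite lee_fin; lra.
Qed.

End InfConv.
End InfConvolution.

(** * Biconjugation *)

(** Lets the parameter of a segment tend to 0 in a variational inequality. *)
Lemma ler_of_first_order (R : realFieldType) (a b S : R) : 0 <= S ->
  (forall t, 0 < t < 1 -> a <= b + t * S) -> a <= b.
Proof.
move=> S0 h; apply/ler_addgt0Pr => e e0.
have d0 : 0 < S + e + 1 by lra.
apply: le_trans (h (e / (S + e + 1)) _) _.
  by rewrite divr_gt0//= ltr_pdivrMr// mul1r; lra.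
by rewrite lerD2l mulrAC ler_pdivrMr// ler_pM2l//; lra.
Qed.

Section FenchelMoreau.
Local Open Scope ereal_scope.
Variables (R : realType) (n : nat) (g : 'cV[R]_n -> \bar R).
Local Notation V := 'cV[R]_n.
Hypotheses (gN : forall x, g x != -oo) (gconv : convex_ereal g)
  (glsc : lower_semicontinuous g).
Variables (C D : R) (C0 : (0 <= C)%R)
  (glow : forall x, (- (C * enorm x) - D)%:E <= g x).

Lemma legendre_double_le x : legendre (legendre g) x <= g x.
Proof.
apply: legendre_le => y; have := legendre_ub g y x; rewrite dotvC.
have := gN x; case: (g x) => [r| |]//; last by rewrite leey.
case: (legendre g y) => [s| |]// _; last by rewrite addeNy leNye.
by rewrite -!EFinB !lee_fin; lra.
Qed.

(** The minimizer y of z |-> g(z) + k/2 |x0 - z|^2 has the subgradient k(x0 - y), and the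
    affine function that it defines takes at x0 a value not below the minimum. For large k
    the minimum is at least a: near x0 because g does, and far from x0 because the
    quadratic term outweighs the linear lower bound of g. This covers points x0 outside
    of the domain of g as well. *)
Lemma affine_minorant (x0 : V) (a : R) : a%:E < g x0 -> (exists x, g x != +oo) ->
  exists (p : V) (b : R), (a <= dotv p x0 - b)%R /\ forall z, (dotv p z - b)%:E <= g z.
Proof.
move=> ax0 [x1 x1oo].
have [e e0 he] : exists2 e : R, (0 < e)%R & forall y, (enorm (x0 - y) < e)%R -> a%:E < g y.
  have := lsc_near glsc ax0; move=> /nbhs_ballP[e /= e0 he]; exists e => // y xy.
  by apply: he; rewrite -ball_normE /=; apply: le_lt_trans xy; exact: mx_norm_le_enorm.
pose E := (C * enorm x0 + `|D| + `|a|)%R.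
have E0 : (0 <= E)%R by rewrite !addr_ge0// mulr_ge0// enorm_ge0.
(* with this k, the bound k/2 s^2 - C s - E is nonnegative for all s >= e *)
pose k := (2 / e * (C + E / e + 1))%R.
have k0 : (0 < k)%R by rewrite mulr_gt0 ?divr_gt0// ltr_wpDl// addr_ge0// divr_ge0// ltW.
pose f y := g y + (k / 2 * enorm (x0 - y) ^+ 2)%:E.
have bound y : (k / 2 * enorm (x0 - y) ^+ 2 - C * enorm (x0 - y) - C * enorm x0 - D)%:E <= f y.
  rewrite /f; apply: le_trans (leeD2r _ (glow y)).
  rewrite -EFinD lee_fin.
  have : (enorm y <= enorm (x0 - y) + enorm x0)%R.
    have -> : y = (- (x0 - y) + x0)%R by rewrite opprB subrK.
    by apply: le_trans (ler_enormD _ _) _; rewrite enormN opprB subrK.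
  move=> /(ler_wpM2l C0); lra.
have far y : (e <= enorm (x0 - y))%R -> a%:E <= f y.
  move=> ey; apply: le_trans (bound y); rewrite lee_fin.
  set s := enorm (x0 - y) in ey *.
  have s0 : (0 < s)%R by exact: lt_le_trans ey.
  have k2 : (k / 2 = (C + E / e + 1) / e)%R by rewrite /k; field; rewrite gt_eqF.
  have h1 : ((C + E / e + 1) <= k / 2 * s)%R.
    rewrite k2 -mulrA ler_peMr//; last by rewrite mulrC ler_pdivlMr ?mul1r.
    by rewrite !addr_ge0// divr_ge0// ltW.
  have h2 : ((C + E / e + 1) * s <= k / 2 * s ^+ 2)%R.
    by rewrite expr2 mulrA ler_pM2r.
  have h3 : (E <= E / e * s)%R.
    by rewrite -mulrA ler_peMr// mulrC ler_pdivlMr ?mul1r.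
  have hD : (D <= `|D|)%R by exact: ler_norm.
  have ha : (a <= `|a|)%R by exact: ler_norm.
  have hE : E = (C * enorm x0 + `|D| + `|a|)%R by [].
  move: h2 h3; rewrite !mulrDl mul1r.
  move: (E / e * s)%R (k / 2 * s ^+ 2)%R => u v; lra.
have [y ymin] : exists y, forall z, f y <= f z.
  apply: lsc_coercive_min.
    apply: near_lsc => y b /lte_split_add [//|//|b1 [b2 [b1y b2y b12]]].
    have n1 := lsc_near glsc b1y.
    have n2 : \forall z \near y, (b2 < k / 2 * enorm (x0 - z) ^+ 2)%R.
      move: b2y; rewrite lte_fin -ltr_pdivrMl ?divr_gt0// => b2y.
      have : \forall z \near y, ((k / 2)^-1 * b2 < enorm (x0 - z) ^+ 2)%R.
        exact: continuous_sqr_dist (lt_nbhsr b2y).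
      by apply: filterS => z; rewrite /= ltr_pdivrMl ?divr_gt0.
    apply: filterS2 n1 n2 => z h1 h2.
    rewrite /f; apply: (@le_lt_trans _ _ (b1%:E + b2%:E)); first by rewrite -EFinD lee_fin.
    by apply: lteD => //; rewrite lte_fin.
  move=> A.
  have [B [B1 BA]] : exists B : R, (1 <= B)%R /\ (A + C * enorm x0 + D <= B)%R.
    exists (`|A + C * enorm x0 + D| + 1)%R; split; first by rewrite lerDr.
    by apply: le_trans (ler_norm _) _; rewrite lerDl.
  exists ((B + C) * 2 / k + 1 + enorm x0)%R => z zM.
  apply: le_trans (bound z); rewrite lee_fin.
  have : (enorm z <= enorm (x0 - z) + enorm x0)%R.
    have -> : z = (- (x0 - z) + x0)%R by rewrite opprB subrK.
    by apply: le_trans (ler_enormD _ _) _; rewrite enormN opprB subrK.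
  move: zM; move: (enorm (x0 - z)) (enorm z) => s r zM h.
  have BC0 : (0 < B + C)%R by rewrite ltr_wpDr// (lt_le_trans _ B1).
  have hM : ((B + C) * 2 / k + 1 <= s)%R.
    by rewrite -(lerD2r (enorm x0)); exact: le_trans h.
  have h0 : (0 <= (B + C) * 2 / k)%R by rewrite divr_ge0 ?ltW// mulr_gt0.
  have s1 : (1 <= s)%R by apply: le_trans hM; rewrite lerDr.
  have s0 : (0 < s)%R by exact: lt_le_trans s1.
  have h1 : (B + C <= k / 2 * s)%R.
    rewrite -(@ler_pM2l _ (2 / k))%R ?divr_gt0//.
    have -> : (2 / k * (k / 2 * s) = s)%R by field; rewrite gt_eqF.
    have -> : (2 / k * (B + C) = (B + C) * 2 / k)%R by ring.
    by apply: le_trans hM; rewrite lerDl.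
  have h2 : ((B + C) * s <= k / 2 * s ^+ 2)%R by rewrite expr2 mulrA ler_pM2r.
  have h3 : (B <= B * s)%R by rewrite ler_peMr// (le_trans _ B1).
  move: h2; rewrite mulrDl; move: (k / 2 * s ^+ 2)%R => v; lra.
have afy : a%:E <= f y.
  have [/far//|/he ay] := leP e (enorm (x0 - y)).
  apply: (le_trans (ltW ay)); rewrite /f leeDl// lee_fin mulr_ge0 ?sqr_ge0//.
  by rewrite divr_ge0// ltW.
have [r yr] : exists r, g y = r%:E.
  have := ymin x1; rewrite /f; have := gN y; have := gN x1; move: x1oo.
  by case: (g x1) => [r1| |]//; case: (g y) => [r| |]// _ _ _; exists r.
exists (k *: (x0 - y))%R, (k * dotv (x0 - y) y - r)%R; split.
  move: afy; rewrite /f yr -EFinD lee_fin sqr_enorm dotvZl.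
  have -> : dotv (x0 - y)%R x0 = (dotv (x0 - y)%R (x0 - y)%R + dotv (x0 - y)%R y)%R.
    by rewrite -dotvDr subrK.
  have := dotvv_ge0 (x0 - y)%R; nra.
move=> z; case ez: (g z) => [w| |]; [|exact: leey|by have := gN z; rewrite ez].
rewrite lee_fin dotvZl.
(* y is optimal along the segment from y to z *)
have step (t : R) : (0 < t < 1)%R ->
    (k * dotv (x0 - y)%R (z - y)%R <= w - r + t * (k / 2 * dotv (z - y) (z - y)))%R.
  move=> t01; have /andP[t0 t1] := t01.
  have := convex_ereal_le (x := z) (y := y) (r := w) (s := r) gconv t01.
  rewrite ez yr !lexx => /(_ isT isT) hz.
  have := ymin (t *: z + (1 - t) *: y)%R; rewrite /f yr -EFinD => hy.
  have := le_trans hy (leeD2r _ hz); rewrite -EFinD lee_fin !sqr_enorm.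
  have -> : (x0 - (t *: z + (1 - t) *: y) = (x0 - y) + (- t) *: (z - y))%R.
    by apply/matrixP => i j; rewrite !mxE; ring.
  rewrite dotv_sqrDZ.
  move: (dotv (x0 - y) (x0 - y)) (dotv (x0 - y) (z - y)) (dotv (z - y) (z - y)).
  by move=> P Q S h; rewrite -(ler_pM2l t0); lra.
have opt : (k * dotv (x0 - y)%R (z - y)%R <= w - r)%R.
  apply: ler_of_first_order step.
  by rewrite mulr_ge0 ?dotvv_ge0// divr_ge0// ltW.
move: opt; rewrite dotvDr dotvNr; lra.
Qed.

Theorem fenchel_moreau x : legendre (legendre g) x = g x.
Proof.
have [goo|/existsNP[x1 x1oo]] := pselect (forall x, g x = +oo).
  have gL y : legendre g y = -oo.
    apply/eqP; rewrite -leeNy_eq; apply: legendre_le => z.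
    by rewrite goo addeNy.
  rewrite goo; apply/eqP; rewrite -leye_eq.
  by have := legendre_ub (legendre g) x 0%R; rewrite gL.
apply/eqP; rewrite eq_le legendre_double_le/= leNgt; apply/negP => h.
have [a [ha ag]] := ereal_between h.
have [p [b [ab hb]]] := affine_minorant ag (ex_intro _ x1 (introN eqP x1oo)).
have Lp : legendre g p <= b%:E.
  apply: legendre_le => z; have := hb z.
  case: (g z) => [w| |]//; last by rewrite addeNy leNye.
  by rewrite -EFinB !lee_fin; lra.
have := le_lt_trans (legendre_ub (legendre g) x p) ha; apply/negP; rewrite -leNgt.
apply: (@le_trans _ _ ((dotv x p)%:E - b%:E)).
  by rewrite -EFinB lee_fin dotvC.
by rewrite leeD2l// leeN2.
Qed.

End FenchelMoreau.

(** * Positively spanning slopes and coercivity *)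

Section PositiveSpanning.
Variables (R : realType) (n : nat).
Local Notation V := 'cV[R]_n.
Local Open Scope ereal_scope.

(** The signed basis vectors stand for the whole space, so that a finite subfamily is found
    without adding elements of positive hulls. *)
Definition pos_spanning (P : set V) : Prop :=
  forall (i : 'I_n) (b : bool), pos_hull P ((-1) ^+ b *: delta_mx i 0)%R.

Lemma pos_hullS (P Q : set V) : P `<=` Q -> pos_hull P `<=` pos_hull Q.
Proof. by move=> PQ x [k [a [l [Pa l0 ->]]]]; exists k, a, l; split=> // i; exact/PQ. Qed.

Lemma pos_spanningS (P Q : set V) : P `<=` Q -> pos_spanning P -> pos_spanning Q.
Proof. by move=> PQ sP i b; exact: pos_hullS (sP i b). Qed.

Lemma pos_hull_pos_spanning (P : set V) : pos_hull P = [set: V] -> pos_spanning P.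
Proof. by move=> PT i b; rewrite PT. Qed.

Lemma pos_spanning_nonempty (P : set V) : (0 < n)%N -> pos_spanning P -> P !=set0.
Proof.
move=> n0 /(_ (Ordinal n0) false)[[|k] [a [l [Pa _]]]]; last by exists (a ord0); exact: Pa.
rewrite big_ord0 expr0 scale1r => /matrixP/(_ (Ordinal n0) 0%R)/eqP.
by rewrite !mxE !eqxx oner_eq0.
Qed.

(** Each of the 2n signed basis vectors uses finitely many generators. *)
Lemma pos_spanning_finite (P : set V) : pos_spanning P ->
  exists s : seq V, [set` s] `<=` P /\ pos_spanning [set` s].
Proof.
move=> sP.
have gen (ib : 'I_n * bool) : exists s : seq V,
    [set` s] `<=` P /\ pos_hull [set` s] ((-1) ^+ ib.2 *: delta_mx ib.1 0)%R.
  have [k [a [l [Pa l0 e]]]] := sP ib.1 ib.2.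
  exists [seq a j | j <- enum 'I_k]; split; first by move=> _ /= /mapP[j _ ->].
  exists k, a, l; split=> // j /=; apply/mapP; exists j => //.
  by rewrite mem_enum.
have [s hs] := choice gen.
exists (flatten [seq s ib | ib <- enum {: 'I_n * bool}]); split.
  by move=> x /= /flattenP[_ /mapP[ib _ ->]]; apply: (hs ib).1.
move=> i b; apply: pos_hullS (hs (i, b)).2 => x /= xs.
by apply/flattenP; exists (s (i, b)) => //; apply/mapP; exists (i, b); rewrite ?mem_enum.
Qed.

Section EnvCoercive.
Variables (I : Type) (A : set I) (y : I -> V) (v : I -> \bar R).
Let P : set V := y @` [set i | A i /\ v i < +oo].

(** A bound on the supremum bounds each of the affine functions above, hence the linear
    form of every positive combination of their slopes. *)
Lemma env_sublevel_pos_hull (a : R) (w : V) : pos_hull P w ->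
  exists b : R, forall x, env A y v x < a%:E -> (dotv x w <= b)%R.
Proof.
move=> [k [p [l [Pp l0 ->]]]].
have gen j : exists b : R, forall x, env A y v x < a%:E -> (dotv x (p j) <= b)%R.
  have [i [Ai vi] <-] := Pp j; move: vi; case ev: (v i) => [r| |]// _.
    exists (a + r)%R => x xa; have := le_lt_trans (env_ub y v x Ai) xa.
    by rewrite ev -EFinB lte_fin ltrBlDr => /ltW.
  by exists 0%R => x /(le_lt_trans (env_ub y v x Ai)); rewrite ev.
have [b hb] := choice gen.
exists (\sum_(j < k) l j * b j)%R => x xa; rewrite dotv_sumr; apply: ler_sum => j _.
by rewrite dotvZr ler_wpM2l// hb.
Qed.

(** On a sublevel set all 2n signed coordinates are bounded above. *)
Lemma env_coercive : pos_spanning P -> coercive (env A y v).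
Proof.
move=> sP a.
have [b hb] := choice (fun ib : 'I_n * bool => env_sublevel_pos_hull a (sP ib.1 ib.2)).
pose M : R := (\sum_ib `|b ib|)%R.
have bM ib : (b ib <= M)%R.
  by apply: le_trans (ler_norm _) _; rewrite /M (bigD1 ib)//= lerDl sumr_ge0.
exists (n%:R * M + 1)%R => x xM; rewrite leNgt; apply/negP => xa.
have xi i : (`|x i 0| <= M)%R.
  have := hb (i, true) _ xa; have := hb (i, false) _ xa; rewrite /= !dotv_delta.
  rewrite expr0 expr1 mul1r mulN1r ler_norml lerNl => h1 h2.
  by rewrite (le_trans _ h2) ?lerN2// (le_trans h1).
have : (enorm x <= n%:R * M)%R.
  apply: le_trans (enorm_le_mx_norm _) _; rewrite ler_wpM2l//.
  rewrite [leLHS]/Num.Def.normr /= mx_normrE; apply/bigmax_leP; split=> [|[i j] _ /=].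
    by rewrite sumr_ge0.
  by rewrite (ord1 j) xi.
by rewrite leNgt (lt_le_trans _ xM)// ltrDl.
Qed.

Lemma env_Conv_c : (0 < n)%N -> pos_spanning P -> (exists x, env A y v x != +oo) ->
  Conv_c (env A y v).
Proof.
move=> n0 sP envoo; have [_ [i [Ai vi] _]] := pos_spanning_nonempty n0 sP.
have envN x : env A y v x != -oo by exact: env_neqNy Ai vi.
split=> //; [exact: env_convex|exact: env_lsc|exact: env_coercive].
Qed.

End EnvCoercive.

Lemma env_sub (I : Type) (A B : set I) (y : I -> V) (v : I -> \bar R) x :
  A `<=` B -> env A y v x <= env B y v x.
Proof. by move=> AB; apply: env_le => i Ai; apply: env_ub; exact: AB. Qed.

Lemma env_fin_lt (k : nat) (y : 'I_k -> V) (v : 'I_k -> R) x :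
  env setT y (fun i => (v i)%:E) x < +oo.
Proof.
apply: (@le_lt_trans _ _ (\sum_(i < k) `|dotv x (y i) - v i|)%R%:E); last by rewrite ltry.
apply: env_le => i _; rewrite -EFinB lee_fin; apply: le_trans (ler_norm _) _.
by rewrite (bigD1 i)//= lerDl sumr_ge0.
Qed.

End PositiveSpanning.

(** * Outer linearizations of rotated functions *)

Section OuterLinearization.
Variables (R : realType) (n : nat).
Local Notation V := 'cV[R]_n.
Local Open Scope ereal_scope.
Implicit Types (psi : V -> \bar R) (t : 'M[R]_n).

(** The supremum that defines the offset is attained at minus the conjugate. *)
Lemma lin_constE psi y : (forall x, psi x != -oo) -> (exists x, psi x != +oo) ->
  lin_const psi y = - legendre psi y.
Proof.
move=> psiN psioo; apply/eqP; rewrite eq_le; apply/andP; split.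
  apply: ge_ereal_sup => c [coo hc]; rewrite leeNr; apply: legendre_le => x.
  have := hc x; have := psiN x; rewrite dotvC; case: c coo {hc} => [c| |]// _; last by rewrite leey.
  case: (psi x) => [r| |]// _; last by rewrite addeNy leNye.
  rewrite -EFinD -EFinB -EFinN !lee_fin; lra.
have := legendre_neqNy y psioo; case eL: (legendre psi y) => [r| |]// _.
- apply: ereal_sup_ubound; split; first by rewrite ltry.
  move=> x; have := legendre_ub psi y x; rewrite eL dotvC; have := psiN x.
  case: (psi x) => [s| |]// _; last by rewrite leey.
  rewrite -EFinB !lee_fin; lra.
- exact: leNye.
Qed.

Lemma outer_linE psi Y : (forall x, psi x != -oo) -> (exists x, psi x != +oo) ->
  outer_lin psi Y = env Y id (legendre psi).
Proof.
move=> psiN psioo; apply/funext => x; congr ereal_sup.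
by apply: eq_imagel => y _; rewrite /lin lin_constE.
Qed.

Lemma env_legendre_le psi Y x : (forall x, psi x != -oo) ->
  env Y id (legendre psi) x <= psi x.
Proof.
by move=> psiN; apply: le_trans (legendre_double_le psiN x); exact: env_sub.
Qed.

Lemma dotv_mulmx t (x y : V) : dotv (t *m x)%R y = dotv x (t^T *m y)%R.
Proof.
rewrite /dotv; under eq_bigr do rewrite mxE mulr_suml.
rewrite exchange_big; apply: eq_bigr => j _ /=.
by rewrite mxE mulr_sumr; apply: eq_bigr => i _; rewrite mxE mulrCA mulrA.
Qed.

Section Orthogonal.
Variable t : 'M[R]_n.
Hypothesis ot : orthogonal_group t.

Lemma orthogonal_unit : t \in unitmx.
Proof. by have [] := mulmx1_unit ot. Qed.

Lemma orthogonal_invmx : invmx t = t^T%R.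
Proof. by rewrite -[RHS]mulmx1 -(mulmxV orthogonal_unit) mulmxA ot mul1mx. Qed.

Lemma enorm_orthogonal (x : V) : enorm (invmx t *m x) = enorm x.
Proof.
rewrite orthogonal_invmx /enorm dotv_mulmx trmxK mulmxA.
by rewrite (mulmx1C ot) mul1mx.
Qed.

Lemma legendre_rotate psi y : legendre (rotate t psi) y = legendre psi (invmx t *m y)%R.
Proof.
apply/eqP; rewrite eq_le; apply/andP; split; apply: legendre_le => x.
  apply: le_trans (legendre_ub psi _ (invmx t *m x)%R).
  rewrite {1}orthogonal_invmx dotv_mulmx trmxK mulmxA mulmxV ?orthogonal_unit//.
  by rewrite mul1mx.
apply: le_trans (legendre_ub _ _ (t *m x)%R).
rewrite /rotate mulmxA mulVmx ?orthogonal_unit// mul1mx.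
by rewrite orthogonal_invmx dotv_mulmx trmxK.
Qed.

Lemma rotate_neqNy psi : (forall x, psi x != -oo) -> forall x, rotate t psi x != -oo.
Proof. by move=> psiN x; exact: psiN. Qed.

Lemma rotate_proper psi : (exists x, psi x != +oo) -> exists x, rotate t psi x != +oo.
Proof.
move=> [x xoo]; exists (t *m x)%R.
by rewrite /rotate mulmxA mulVmx ?orthogonal_unit// mul1mx.
Qed.

Lemma outer_lin_rotate psi Y : Conv_c psi ->
  outer_lin (rotate t psi) Y = env Y id (fun y => legendre psi (invmx t *m y)%R).
Proof.
move=> cpsi; rewrite outer_linE; last 2 first.
- by apply: rotate_neqNy; exact: Conv_c_ninfty.
- by apply: rotate_proper; exact: Conv_c_proper.
by congr env; apply/funext => y; exact: legendre_rotate.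
Qed.

Lemma Conv_c_outer_lin_rotate psi (Y Yo : set V) : (0 < n)%N -> Conv_c psi ->
  Yo `<=` Y -> pos_spanning Yo -> (forall y, Yo y -> legendre psi (invmx t *m y)%R < +oo) ->
  Conv_c (outer_lin (rotate t psi) Y).
Proof.
move=> n0 cpsi YoY sYo fin; rewrite outer_lin_rotate//; apply: env_Conv_c => //.
  by apply: pos_spanningS sYo => y Yoy; exists y => //; split; [exact: YoY|exact: fin].
have [x xoo] := rotate_proper (Conv_c_proper cpsi); exists x.
rewrite -ltey; move: xoo; rewrite -ltey; apply: le_lt_trans.
have := env_legendre_le Y x (rotate_neqNy (Conv_c_ninfty cpsi)).
by congr (env _ _ _ _ <= _); apply/funext => y; rewrite legendre_rotate.
Qed.

End Orthogonal.
End OuterLinearization.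

(** * Asplund sums of log-concave functions *)

Section ExponentialOfConvolution.
Variables (R : realType) (n : nat).
Local Notation V := 'cV[R]_n.
Local Open Scope ereal_scope.
Implicit Types (q psi : V -> \bar R).

Lemma exp_negK psi : neg_log (exp_neg psi) = psi.
Proof. by apply/funext => x; rewrite /neg_log /exp_neg expeRK oppeK. Qed.

Lemma le_exp_neg psi phi (x : V) : psi x <= phi x -> exp_neg phi x <= exp_neg psi x.
Proof. by move=> h; rewrite lee_expeR leeN2. Qed.

Lemma LC_c_exp_neg psi : Conv_c psi -> LC_c (exp_neg psi).
Proof. by exists psi. Qed.

Lemma homothety_exp_neg (l : R) q : (0 < l)%R -> (forall x, q x != -oo) ->
  homothety l (exp_neg q) = exp_neg (epi_scale l q).
Proof.
move=> l0 qN; apply/funext => x; rewrite /homothety /exp_neg /epi_scale.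
have := qN (l^-1 *: x)%R; case: (q _) => [r| |]// _.
  change ((expR (- r))%:E `^ l = (expR (- (l * r)))%:E).
  by rewrite poweR_EFin -expRM mulNr mulrC.
rewrite gt0_muley ?lte_fin//; change (0%:E `^ l = 0%:E :> \bar R).
by rewrite poweR0r// gt_eqF.
Qed.

(** Attainment of the infimal convolution makes exp commute with the infimum. *)
Lemma asplund_exp_neg psi phi : Conv_c psi -> Conv_c phi ->
  asplund (exp_neg phi) (exp_neg psi) = exp_neg (inf_conv psi phi).
Proof.
move=> cpsi cphi; apply/funext => x.
have prodE y : exp_neg phi y * exp_neg psi (x - y)%R = expeR (- (psi (x - y)%R + phi y)).
  rewrite /exp_neg -expeRD addeC.
  have := Conv_c_ninfty cpsi (x - y)%R; have := Conv_c_ninfty cphi y.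
  by case: (psi _) => [r| |]//; case: (phi _) => [s| |]// _ _; rewrite -EFinD -!EFinN opprD.
apply/eqP; rewrite eq_le; apply/andP; split.
  apply: ge_ereal_sup => _ [y _ <-]; rewrite prodE lee_expeR leeN2.
  by apply: ereal_inf_lbound; exists y.
have [y e] := inf_conv_attained cpsi cphi x.
by apply: ereal_sup_ubound; exists y => //; rewrite prodE /exp_neg e.
Qed.

(** Both sides are compared piece by piece: at x = z + (x - z) the affine function with
    the mean offset is the mean of the two affine functions at z / l and at
    (x - z) / (1 - l). *)
Lemma env_mean_le_inf_conv (I : Type) (A : set I) (y : I -> V) (v1 v2 v : I -> \bar R) (l : R) x :
  (0 < l < 1)%R -> (forall i, A i -> v1 i != -oo) -> (forall i, A i -> v2 i != -oo) ->
  (forall i, A i -> l%:E * v1 i + (1 - l)%:E * v2 i <= v i) ->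
  env A y v x <= inf_conv (epi_scale (1 - l) (env A y v2)) (epi_scale l (env A y v1)) x.
Proof.
move=> /andP[l0 l1] v1N v2N vl; have l1' : (0 < 1 - l)%R by rewrite subr_gt0.
apply: env_le => i Ai; apply: le_ereal_inf_tmp => _ [z _ <-].
rewrite /epi_scale.
have := env_ub y v1 (l^-1 *: z)%R Ai; have := env_ub y v2 ((1 - l)^-1 *: (x - z))%R Ai.
have := v1N i Ai; have := v2N i Ai; have := vl i Ai.
case e1: (v1 i) => [r1| |]//; last first.
  case e2: (v2 i) => [r2| |]//; rewrite ?gt0_muley ?lte_fin//= leye_eq => /eqP -> _ _ _ _;
  by rewrite addeNy leNye.
case e2: (v2 i) => [r2| |]//; last first.
  rewrite gt0_muley ?lte_fin//= leye_eq => /eqP -> _ _ _ _.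
  by rewrite addeNy leNye.
move=> hv _ _ h2 h1.
apply: (@le_trans _ _ ((dotv x (y i))%:E - (l%:E * r1%:E + (1 - l)%:E * r2%:E))).
  by rewrite leeD2l// leeN2.
apply: le_trans (leeD (lee_wpmul2l _ h2) (lee_wpmul2l _ h1)); last 2 first.
- by rewrite lee_fin ltW.
- by rewrite lee_fin ltW.
rewrite -!(EFinM, EFinB, EFinD) lee_fin.
have -> : dotv x (y i) = (dotv z (y i) + dotv (x - z)%R (y i))%R.
  by rewrite -dotvDl addrC subrK.
rewrite !dotvZl le_eqVlt; apply/orP; left; apply/eqP.
by field; rewrite !gt_eqF.
Qed.

End ExponentialOfConvolution.

(** * Superlevel sets of the functional *)

Section Functional.
Variables (R : realType) (n : nat) (F : ('cV[R]_n -> \bar R) -> \bar R).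
Local Notation V := 'cV[R]_n.
Local Open Scope ereal_scope.
Hypotheses (F_val : nonneg_valued F) (F_usc : hypo_usc F) (F_lc : log_concave F)
  (F_mono : monotone_increasing F).
Implicit Types (q : V -> \bar R) (c : \bar R).

(** This is log-concavity seen through the offsets: superlevel sets of the functional
    are convex in v. *)
Lemma superlevel_env_mean (I : Type) (A : set I) (y : I -> V) (v1 v2 v : I -> \bar R) (l : R) c :
  (0 < l < 1)%R -> (forall i, A i -> v1 i != -oo) -> (forall i, A i -> v2 i != -oo) ->
  (forall i, A i -> l%:E * v1 i + (1 - l)%:E * v2 i <= v i) ->
  Conv_c (env A y v1) -> Conv_c (env A y v2) -> Conv_c (env A y v) ->
  c <= F (exp_neg (env A y v1)) -> c <= F (exp_neg (env A y v2)) ->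
  c <= F (exp_neg (env A y v)).
Proof.
move=> l01 v1N v2N vl c1 c2 cv h1 h2; have /andP[l0 l1] := l01.
have l1' : (0 < 1 - l)%R by rewrite subr_gt0.
have lc1 := LC_c_exp_neg c1; have lc2 := LC_c_exp_neg c2.
apply: le_trans (le_geometric_mean l01 (F_val.1 _ lc1) (F_val.1 _ lc2) h1 h2) _.
apply: le_trans (F_lc lc1 lc2 l01) _.
have s1 := Conv_c_epi_scale l0 c1; have s2 := Conv_c_epi_scale l1' c2.
rewrite !homothety_exp_neg//; [|exact: Conv_c_ninfty|exact: Conv_c_ninfty].
rewrite asplund_exp_neg//; apply: F_mono.
- exact/LC_c_exp_neg/Conv_c_inf_conv.
- exact: LC_c_exp_neg.
- by move=> x; apply: le_exp_neg; exact: env_mean_le_inf_conv.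
Qed.

Lemma superlevel_mono q1 q2 c : Conv_c q1 -> Conv_c q2 -> (forall x, q1 x <= q2 x) ->
  c <= F (exp_neg q2) -> c <= F (exp_neg q1).
Proof.
move=> c1 c2 q12 /le_trans; apply; apply: F_mono; try exact: LC_c_exp_neg.
by move=> x; exact: le_exp_neg.
Qed.

(** Since each q_j lies below q, constant sequences are recovery sequences, and only the
    locally uniform lower bound has to be supplied. *)
Lemma hypo_cvg_exp_neg (q_ : nat -> V -> \bar R) q :
  (forall j x, q_ j x <= q x) ->
  (forall x (a : R), a%:E < q x -> exists N, \forall z \near x,
     forall j, (N <= j)%N -> a%:E <= q_ j z) ->
  hypo_cvg (fun j => exp_neg (q_ j)) (exp_neg q).
Proof.
move=> q_q qlow x.
have limsup (x_ : nat -> V) : x_ j @[j --> \oo] --> x ->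
    limn_esup (fun j => exp_neg (q_ j) (x_ j)) <= exp_neg q x.
  move=> x_x; rewrite leNgt; apply/negP => h.
  have [w ew] := expeR_total (le_trans (expeR_ge0 _) (ltW h)).
  move: h; rewrite -ew lte_expeR lteNl => /ereal_between[a [wa ax]].
  have [N hN] := qlow _ _ ax.
  have [M _ hM] := x_x _ hN.
  have : expeR w <= expeR (- a%:E).
    rewrite ew; apply: (@le_trans _ _ (ereal_sup
      ((fun j => exp_neg (q_ j) (x_ j)) @` [set j | (maxn N M <= j)%N]))).
      apply: ereal_inf_lbound; exists [set j | (maxn N M <= j)%N] => //.
      by exists (maxn N M).
    apply: ge_ereal_sup => _ [j jNM <-].
    have {}jNM : (maxn N M <= j)%N := jNM.
    rewrite lee_expeR leeN2.
    apply: hM; first by rewrite /= (leq_trans _ jNM)// leq_maxr.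
    by rewrite (leq_trans _ jNM)// leq_maxl.
  by rewrite lee_expeR leeNr leNgt wa.
split=> //; exists (fun=> x); first exact: cvg_cst.
apply: limn_esup_le_cvg; first by apply: limsup; exact: cvg_cst.
by move=> j; exact: le_exp_neg.
Qed.

Lemma superlevel_closed (q_ : nat -> V -> \bar R) q c :
  (forall j, Conv_c (q_ j)) -> Conv_c q ->
  (forall j x, q_ j x <= q x) ->
  (forall x (a : R), a%:E < q x -> exists N, \forall z \near x,
     forall j, (N <= j)%N -> a%:E <= q_ j z) ->
  (forall j, c <= F (exp_neg (q_ j))) -> c <= F (exp_neg q).
Proof.
move=> cq_ cq q_q qlow hc.
have := F_usc (fun j => LC_c_exp_neg (cq_ j)) (LC_c_exp_neg cq) (hypo_cvg_exp_neg q_q qlow).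
apply: le_trans; apply: le_ereal_inf_tmp => _ [A [N _ NA] <-].
apply: le_trans (hc N) _; apply: ereal_sup_ubound; exists N => //.
by apply: NA => /=.
Qed.

(** Choosing, for each rational box and each rational number, an affine piece above that
    number on the box whenever there is one, yields countably many pieces that generate
    the envelope. Their finite subfamilies increase to it locally uniformly from below.
    The family s keeps the finite envelopes coercive. *)
Lemma superlevel_of_finite (Y : set V) (g : V -> \bar R) (s : seq V) c :
  (0 < n)%N -> [set` s] `<=` Y -> pos_spanning [set` s] ->
  (forall y, y \in s -> g y < +oo) -> (forall y, Y y -> g y != -oo) ->
  Conv_c (env Y id g) ->
  (forall L : seq V, (forall y, y \in L -> Y y /\ g y < +oo) -> pos_spanning [set` L] ->
     c <= F (exp_neg (env [set` L] id g))) ->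
  c <= F (exp_neg (env Y id g)).
Proof.
move=> n0 sY ss sfin gN cq hc.
pose box (b : 'cV[rat]_n * rat) : set V :=
  [set z | forall i, (`|z i 0 - ratr (b.1 i 0)| < ratr b.2)%R].
pose ok (b : 'cV[rat]_n * rat * rat) y :=
  forall z, box b.1 z -> (ratr b.2)%:E <= (dotv z y)%:E - g y.
have [y0 sy0] := pos_spanning_nonempty n0 ss.
have /choice[pk hpk] : forall b, exists y, (Y y /\ g y < +oo) /\
    ((exists y', (Y y' /\ g y' < +oo) /\ ok b y') -> ok b y).
  move=> b; have [[y' [h1 h2]]|h] := pselect (exists y', (Y y' /\ g y' < +oo) /\ ok b y').
    by exists y'.
  by exists y0; split=> //; split; [exact: sY|exact: sfin].
pose e k := if unpickle k is Some b then pk b else y0.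
have eY k : Y (e k) /\ g (e k) < +oo.
  rewrite /e; case: (unpickle k) => [b|]; first exact: (hpk b).1.
  by split; [exact: sY|exact: sfin].
pose L j := s ++ mkseq e j.
have LY j y : y \in L j -> Y y /\ g y < +oo.
  rewrite mem_cat => /orP[ys|/mapP[k _ ->]]; last exact: eY.
  by split; [exact: sY|exact: sfin].
have sL j : pos_spanning [set` L j].
  by apply: pos_spanningS ss => y /= ys; rewrite mem_cat ys.
have envLY j x : env [set` L j] id g x <= env Y id g x.
  by apply: env_sub => y /= /LY[].
apply: (@superlevel_closed (fun j => env [set` L j] id g)) => //.
- move=> j; apply: env_Conv_c => //.
    by apply: pos_spanningS (sL j) => y /= yL; exists y => //; split=> //; exact: (LY _ _ yL).2.
  have [x xoo] := Conv_c_proper cq; exists x.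
  by rewrite -ltey (le_lt_trans (envLY j x))// ltey.
- move=> x a /ereal_sup_gt[_ [y Yy <-]] axy.
  have [r gr] : exists r, g y = r%:E.
    by have := gN _ Yy; case: (g y) axy => [r| |]//; exists r.
  move: axy; rewrite gr -EFinB lte_fin => axy.
  have [a' /[!in_itv]/= /andP[aa' a'x]] := rat_in_itvoo axy.
  have near_x : \forall z \near x, (ratr a' + r < dotv z y)%R.
    apply: (@continuous_dotvr R n y x _ (lt_nbhsr _)).
    by rewrite -ltrBrDr.
  have [d /= d0 hd] := (iffLR (nbhs_ballP _ _)) near_x.
  have [rho /[!in_itv]/= /andP[rho0 rhod]] := rat_in_itvoo (divr_gt0 d0 (ltr0n R 2)).
  have /choice[cen hcen] : forall i, exists q : rat, (`|x i 0 - ratr q| < ratr rho / 2)%R.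
    move=> i; have : (x i 0 - ratr rho / 2 < x i 0 + ratr rho / 2)%R.
      by rewrite ltrD2l gt0_cp// divr_gt0.
    move=> /rat_in_itvoo[q /[!in_itv]/= /andP[q1 q2]]; exists q.
    by rewrite ltr_norml; lra.
  pose b : 'cV[rat]_n * rat * rat := (\col_i cen i, rho, a').
  have okb : ok b (pk b).
    apply: (hpk b).2; exists y; split; first by rewrite gr ltry.
    move=> z /= zb; rewrite gr -EFinB lee_fin ltW// ltrBrDr.
    apply: hd; split=> // i j; rewrite (ord1 j) /ball /=.
    have := zb i; have := hcen i; rewrite mxE => h1 h2.
    have -> : (x i 0 - z i 0 = (x i 0 - ratr (cen i)) - (z i 0 - ratr (cen i)))%R by ring.
    apply: le_lt_trans (ler_normB _ _) _.
    have -> : (d = d / 2 + d / 2)%R by rewrite -splitr.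
    apply: ltrD; [apply: lt_trans h1 _|exact: lt_trans h2 _].
    by apply: lt_trans rhod; rewrite ltr_pdivrMr// ltr_pMr// ltr1n.
  exists (pickle b).+1; apply/nbhs_ballP; exists (ratr rho / 2)%R => /=; first by rewrite divr_gt0.
  move=> z [_ xz] j jb.
  have zb : box b.1 z.
    move=> i /=; rewrite mxE.
    have -> : (z i 0 - ratr (cen i) = (x i 0 - ratr (cen i)) - (x i 0 - z i 0))%R by ring.
    apply: le_lt_trans (ler_normB _ _) _; rewrite [ltRHS]splitr.
    by apply: ltrD; [exact: hcen|exact: xz].
  apply: (@le_trans _ _ (ratr a')%:E); first by rewrite lee_fin ltW.
  apply: le_trans (okb _ zb) _; apply: (@env_ub _ _ _ [set` L j] id g z (pk b)) => /=.
  rewrite mem_cat; apply/orP; right; apply/mapP; exists (pickle b).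
    by rewrite mem_iota.
  by rewrite /e pickleK.
- by move=> j; apply: hc => //; exact: LY.
Qed.

End Functional.

(** * Means over closed convex sets *)

Section ClosedConvexSets.
Variables (R : realType) (k : nat) (C : set 'cV[R]_k).
Hypotheses (closedC : closed C)
  (convexC : forall u v (l : R), 0 < l < 1 -> C u -> C v -> C (l *: u + (1 - l) *: v)).

(** The squared distance to a, set to +oo outside of C, is lower semicontinuous and
    coercive. *)
Lemma nearest_point (a : 'cV[R]_k) : C !=set0 ->
  exists2 p, C p & forall v, C v -> dotv (a - p) (v - p) <= 0.
Proof.
move=> [v0 Cv0].
pose f (v : 'cV[R]_k) : \bar R := if `[< C v >] then (enorm (a - v) ^+ 2)%:E else +oo%E.
have fC v : C v -> f v = (enorm (a - v) ^+ 2)%:E by rewrite /f => /asboolP ->.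
have [p pmin] : exists p, forall v, (f p <= f v)%E.
  apply: lsc_coercive_min.
    apply: near_lsc => x b; have [Cx|Cx] := pselect (C x).
      rewrite fC// lte_fin => bx.
      have near_x : \forall y \near x, b < enorm (a - y) ^+ 2.
        exact: continuous_sqr_dist (lt_nbhsr bx).
      apply: filterS near_x => y bY; rewrite /f; case: ifP => _; last exact: ltry.
      by rewrite lte_fin.
    move=> _; have near_x : \forall y \near x, ~ C y.
      by apply: open_nbhs_nbhs; split => //; exact: closed_openC.
    by apply: filterS near_x => y Cy; rewrite /f asboolF// ltry.
  move=> A; exists (`|A| + 1 + enorm a) => v av.
  rewrite /f; case: ifP => _; last exact: leey.
  rewrite lee_fin.
  have : enorm v <= enorm (a - v) + enorm a.
    have -> : v = - (a - v) + a by rewrite opprB subrK.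
    by apply: le_trans (ler_enormD _ _) _; rewrite enormN opprB subrK.
  move=> h; have {}h : `|A| + 1 <= enorm (a - v).
    by rewrite -(lerD2r (enorm a)); exact: le_trans h.
  apply: le_trans (ler_norm A) _; have := normr_ge0 A.
  move: (enorm (a - v)) (`|A|) h => s B h B0; nra.
have Cp : C p.
  by apply: contrapT => Cp; have := pmin v0; rewrite (fC _ Cv0) /f asboolF// leye_eq.
exists p => // v Cv.
suff : 2 * dotv (a - p) (v - p) <= 0 by rewrite pmulr_rle0.
apply: (@ler_of_first_order _ _ _ (dotv (v - p) (v - p))); first exact: dotvv_ge0.
move=> t t01; have /andP[t0 t1] := t01.
have := pmin (t *: v + (1 - t) *: p); rewrite !fC//; last exact: convexC.
rewrite lee_fin !sqr_enorm.
have -> : a - (t *: v + (1 - t) *: p) = (a - p) + (- t) *: (v - p).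
  by apply/matrixP => i j; rewrite !mxE; ring.
rewrite dotv_sqrDZ.
move: (dotv (a - p) (a - p)) (dotv (a - p) (v - p)) (dotv (v - p) (v - p)).
by move=> P Q S h; rewrite -(ler_pM2l t0); lra.
Qed.

Local Open Scope ereal_scope.

(** Integrating the inequality <a - p, G - p> <= 0 of the point p nearest to the mean a
    gives |a - p|^2 <= 0. *)
Lemma closed_convex_mean d (T : measurableType d) (mu : probability T R) (D : set T)
    (G : 'I_k -> T -> \bar R) :
  measurable D -> mu D = 1 -> (forall i, mu.-integrable D (G i)) ->
  (forall t, D t -> (forall i, G i t \is a fin_num) -> C (\col_i fine (G i t))) ->
  C (\col_i fine (\int[mu]_(t in D) G i t)).
Proof.
move=> mD muD intG GC; pose a : 'cV[R]_k := \col_i fine (\int[mu]_(t in D) G i t).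
have [N [mN muN Nfin]] : {ae mu, forall t, forall i, D t -> G i t \is a fin_num}.
  by apply: filter_forall => i; exact: (integrable_ae mD (intG i)).
have finDN t : (D `\` N) t -> forall i, G i t \is a fin_num.
  move=> [Dt Nt] i; apply: contrapT => h; apply: Nt; apply: Nfin => /= h'.
  by apply: h; exact: h'.
have muDN : mu (D `\` N) = 1.
  have DN0 : mu (D `&` N) = 0.
    by apply/eqP; rewrite eq_le measure_ge0 andbT -muN le_measure// ?inE//; exact: measurableI.
  by rewrite -[LHS]adde0 -DN0 -measureDI.
have mDN : measurable (D `\` N) by exact: measurableD.
have intGN i : mu.-integrable (D `\` N) (G i).
  by apply: integrableS (intG i) => //; exact: subDsetl.
have GCN t : (D `\` N) t -> C (\col_i fine (G i t)).
  by move=> DNt; apply: GC; [exact: DNt.1|exact: finDN].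
have [t0 DNt0] : (D `\` N) !=set0.
  apply/set0P/eqP => DN0; move: muDN; rewrite DN0 measure0 => /eqP.
  by rewrite eq_sym onee_eq0.
have [p Cp hp] := @nearest_point a (ex_intro _ _ (GCN _ DNt0)).
change (C a); suff -> : a = p by [].
pose w := (a - p)%R.
have intfin i : \int[mu]_(t in D) G i t \is a fin_num by exact: integrable_fin_num.
have intE : \int[mu]_(t in D `\` N) (\sum_(i < k) (w i 0)%:E * G i t) = (dotv w a)%:E.
  rewrite (@integral_sum _ _ _ _ _ mDN _ (fun i t => (w i 0)%:E * G i t)).
    rewrite /dotv -sumEFin; apply: eq_bigr => i _.
    have -> : a i 0%R = fine (\int[mu]_(t in D) G i t) by rewrite mxE.
    rewrite integralZl// EFinM fineK//; congr (_ * _).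
    by rewrite [RHS](negligible_integral mN).
  by move=> i; exact: integrableZl.
have : \int[mu]_(t in D `\` N) (\sum_(i < k) (w i 0)%:E * G i t) <=
       \int[mu]_(t in D `\` N) (cst (dotv w p)%:E) t.
  apply: le_integral => //.
  - apply: (@integrable_sum _ _ _ _ _ mDN _ _ _ (fun i t => (w i 0%R)%:E * G i t)) => i _.
    exact: integrableZl.
  - exact: finite_measure_integrable_cst.
  move=> t /set_mem DNt; have := hp _ (GCN _ DNt).
  rewrite -/w dotvDr dotvNr subr_le0 => h.
  apply: (@le_trans _ _ (dotv w (\col_i fine (G i t)))%:E); last by rewrite lee_fin.
  rewrite /dotv -sumEFin; apply: lee_sum => i _.
  have -> : (\col_j fine (G j t)) i 0%R = fine (G i t) by rewrite mxE.
  by rewrite EFinM fineK//; exact: finDN.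
have -> : \int[mu]_(t in D `\` N) (cst (dotv w p)%:E) t = (dotv w p)%:E.
  by rewrite integral_cst// -[RHS]mule1 -muDN.
rewrite intE lee_fin -subr_le0 -dotvNr -dotvDr -/w.
rewrite -sqr_enorm => h.
have /eqP : (enorm w == 0)%R by rewrite -sqrf_eq0 eq_le h sqr_ge0.
by move=> /enorm_eq0/eqP; rewrite subr_eq0 => /eqP.
Qed.

End ClosedConvexSets.

Section FiniteFamilies.
Variables (R : realType) (n : nat) (F : ('cV[R]_n -> \bar R) -> \bar R).
Local Notation V := 'cV[R]_n.
Hypotheses (n0 : (0 < n)%N) (F_val : nonneg_valued F) (F_usc : hypo_usc F)
  (F_lc : log_concave F) (F_mono : monotone_increasing F).
Local Open Scope ereal_scope.

Section Offsets.
Variables (k : nat) (y : 'I_k -> V) (c : \bar R).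
Hypothesis sy : pos_spanning (range y).

Let fenv (v : 'cV[R]_k) : V -> \bar R := env setT y (fun i => (v i 0)%:E).

Let Conv_c_fenv v : Conv_c (fenv v).
Proof.
apply: env_Conv_c => //; last first.
  by exists 0%R; rewrite -ltey; exact: (@env_fin_lt _ _ _ y (fun i => v i 0%R)).
by apply: pos_spanningS sy => _ [i _ <-]; exists i => //; split=> //; rewrite ltry.
Qed.

Let superlevel := [set v | c <= F (exp_neg (fenv v))].

Lemma convex_superlevel_offsets u v (l : R) : (0 < l < 1)%R ->
  superlevel u -> superlevel v -> superlevel (l *: u + (1 - l) *: v)%R.
Proof.
move=> l01; apply: (superlevel_env_mean F_val F_lc F_mono (l := l)) => //; try exact: Conv_c_fenv.
by move=> i _; rewrite !mxE.
Qed.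

(** For v in the closure, all v + 1/(j+1) belong to the set because it is upward closed,
    and their envelopes increase to that of v. *)
Lemma closed_superlevel_offsets : closed superlevel.
Proof.
move=> v clv.
pose v_ j : 'cV[R]_k := (v + const_mx j.+1%:R^-1)%R.
apply: (superlevel_closed F_usc (q_ := fun j => fenv (v_ j))) => //.
- by move=> j x; apply: env_antitone => i _; rewrite !mxE lee_fin lerDl.
- move=> x a /ereal_sup_gt[_ [i _ <-]]; rewrite -EFinB lte_fin => ax.
  pose d := ((dotv x (y i) - v i 0 - a) / 2)%R.
  have d0 : (0 < d)%R by rewrite divr_gt0// subr_gt0.
  have [N _ hN] := near_infty_natSinv_lt (PosNum d0).
  exists N.
  have near_x : \forall z \near x, (dotv x (y i) - d < dotv z (y i))%R.
    by apply: (@continuous_dotvr R n (y i) x _ (lt_nbhsr _)); rewrite gtrBl.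
  apply: filterS near_x => z hz j Nj.
  apply: le_trans (env_ub y (fun i => ((v_ j) i 0)%:E) z (i := i) _) => //.
  rewrite -EFinB lee_fin !mxE.
  have hj : (j.+1%:R^-1 < d)%R := hN j Nj.
  move: hj hz; rewrite /d; move: (j.+1%:R^-1)%R => e; lra.
- move=> j; have e0 : (0 < j.+1%:R^-1 :> R)%R by rewrite invr_gt0.
  have [w [Cw /= [_ vw]]] := clv _ (nbhsx_ballx v _ e0).
  apply: (superlevel_mono F_mono) Cw => // x; apply: env_antitone => i _.
  rewrite !mxE lee_fin; have := vw i 0%R; rewrite /ball /= ltr_distlC => /andP[_ /ltW].
  by [].
Qed.

End Offsets.

Lemma env_seq (L : seq V) (g : V -> \bar R) :
  env [set` L] id g = env setT (fun i : 'I_(size L) => L`_i)%R (fun i => g L`_i)%R.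
Proof.
apply/funext => x; congr ereal_sup; rewrite eqEsubset; split.
  move=> _ [y /= yL <-]; have ks : (index y L < size L)%N by rewrite index_mem.
  by exists (Ordinal ks) => //=; rewrite nth_index.
by move=> _ [i _ <-]; exists (L`_i)%R => //=; exact: mem_nth.
Qed.

Lemma superlevel_finite_mean d (T : measurableType d) (mu : probability T R) (D : set T)
    (L : seq V) (G : V -> T -> \bar R) (c : \bar R) :
  pos_spanning [set` L] -> measurable D -> mu D = 1 ->
  (forall y, y \in L -> mu.-integrable D (G y)) ->
  (forall t, D t -> (forall y, y \in L -> G y t \is a fin_num) ->
     c <= F (exp_neg (env [set` L] id (G ^~ t)))) ->
  c <= F (exp_neg (env [set` L] id (fun y => \int[mu]_(t in D) G y t))).
Proof.
move=> sL mD muD intG hc; pose y (i : 'I_(size L)) := (L`_i)%R.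
have yL i : y i \in L by exact: mem_nth.
have sy : pos_spanning (range y).
  apply: pos_spanningS sL => z /= zL; have ks : (index z L < size L)%N by rewrite index_mem.
  by exists (Ordinal ks) => //=; rewrite /y nth_index.
have := closed_convex_mean (closed_superlevel_offsets sy (c := c))
  (convex_superlevel_offsets sy (c := c)) mD muD (fun i => intG _ (yL i)).
have E (g : V -> \bar R) : (forall y, y \in L -> g y \is a fin_num) ->
    env [set` L] id g = env setT y (fun i => ((\col_i fine (g (y i))) i 0%R)%:E).
  move=> gfin; rewrite env_seq; congr env; apply/funext => i.
  by rewrite mxE fineK// gfin.
move=> /= mean; rewrite E; last by move=> z /intG; exact: integrable_fin_num.
apply: mean => t Dt finG.
have finG' z : z \in L -> G z t \is a fin_num.
  move=> zL; have ks : (index z L < size L)%N by rewrite index_mem.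
  by have := finG (Ordinal ks); rewrite /y /= nth_index.
by have := hc t Dt finG'; rewrite E.
Qed.

End FiniteFamilies.

(** * The rotation group as a measurable set *)

Section RotationsAreMeasurable.
Variables (R : realType) (n : nat).
Local Notation V := 'cV[R]_n.

Lemma continuous_prodr (T : topologicalType) (I : Type) (r : seq I) (f : I -> T -> R) :
  (forall i, continuous (f i)) -> continuous (fun x => \prod_(i <- r) f i x).
Proof.
move=> cf x; elim: r => [|i r ih].
  by under eq_fun do rewrite big_nil; exact: cvg_cst.
by under eq_fun do rewrite big_cons; apply: cvgM; [exact: cf|exact: ih].
Qed.

Lemma continuous_entries (T : topologicalType) p q (f : T -> 'M[R]_(p, q)) :
  (forall i j, continuous (fun x => f x i j)) -> continuous f.
Proof.
move=> cf x A [P nP PA]; have : \forall z \near x, forall i j, P i j (f z i j).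
  by apply: filter_forall => i; apply: filter_forall => j; exact: cf _ _ _ _ (nP i j).
by apply: filterS => z Pz; exact: PA.
Qed.

Lemma continuous_trmx_mul (x : V) : continuous (fun t : 'M[R]_n => (t^T *m x)%R).
Proof.
apply: continuous_entries => i j.
rewrite (_ : (fun _ => _) = (fun t : 'M[R]_n => \sum_k t k i * x k j)).
  by apply: continuous_sumr => k t; exact: (cvgMr_tmp (@coord_continuous R n n k i t)).
by apply/funext => t; rewrite mxE; apply: eq_bigr => k _; rewrite mxE.
Qed.

Lemma closed_rotation_group : closed (@rotation_group R n).
Proof.
have -> : @rotation_group R n = (\bigcap_(ij : 'I_n * 'I_n)
    [set t : 'M[R]_n | \sum_k t k ij.1 * t k ij.2 = (1%:M : 'M[R]_n) ij.1 ij.2]) `&`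
    [set t : 'M[R]_n | \det t = 1].
  rewrite eqEsubset; split=> t [h dt]; split=> //.
    move=> [i j] _ /=; rewrite -h mxE; apply: eq_bigr => k _; by rewrite mxE.
  apply/matrixP => i j; rewrite -(h (i, j) Logic.I) mxE; apply: eq_bigr => k _.
  by rewrite mxE.
apply: closedI.
  apply: closed_bigI => -[i j] _.
  apply: (@preimage_closed _ _ (fun t : 'M[R]_n => \sum_k t k i * t k j) [set r | r = _]).
    move=> t _; apply: continuous_sumr => k {}t.
    exact: (cvgM (@coord_continuous R n n k i t) (@coord_continuous R n n k j t)).
  exact: closed_eq.
apply: (@preimage_closed _ _ (fun t : 'M[R]_n => \det t) [set r | r = 1]).
  move=> t _; apply: continuous_sumr => s {}t.
  have cprod : continuous (fun t : 'M[R]_n => \prod_i t i (perm.fun_of_perm s i)).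
    by apply: continuous_prodr => i; exact: coord_continuous.
  exact: (cvgMl_tmp (cprod t)).
exact: closed_eq.
Qed.

Lemma measurable_rotation_group : measurable (@rotation_group R n : set (borel_mx R n)).
Proof.
rewrite -(setCK (@rotation_group R n)); apply: measurableC.
by apply: sub_sigma_algebra; exact: closed_openC closed_rotation_group.
Qed.

Local Open Scope ereal_scope.

(** On rotations the inverse is the transpose, which makes the map t |-> h(t^-1 x) lower
    semicontinuous there. *)
Lemma measurable_fun_rotation (h : V -> \bar R) (x : V) : lower_semicontinuous h ->
  measurable_fun (@rotation_group R n : set (borel_mx R n))
    (fun t : borel_mx R n => h (invmx (t : 'M[R]_n) *m x)%R).
Proof.
move=> lh mD; apply: (measurability _ (ErealGenOInfty.measurableE R)).
move=> /= _ [_ [a ->]] <-.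
have -> : @rotation_group R n `&` (fun t => h (invmx t *m x)%R) @^-1` `]a%:E, +oo[ =
          @rotation_group R n `&` [set t | a%:E < h (t^T *m x)%R].
  rewrite eqEsubset; split=> t [Dt]; rewrite /= in_itv/= andbT;
    by rewrite (orthogonal_invmx Dt.1) => h'; split.
apply: measurableI; first exact: measurable_rotation_group.
apply: sub_sigma_algebra.
apply: (@open_comp _ _ (fun t : 'M[R]_n => (t^T *m x)%R) [set y | a%:E < h y]).
  by move=> t _; exact: continuous_trmx_mul.
  by move/lower_semicontinuousP : lh; exact.
exact: measurable_rotation_group.
Qed.

End RotationsAreMeasurable.

(** * Integrals of functions bounded below *)

Section IntegralsBoundedBelow.
Context d (T : measurableType d) (R : realType) (mu : probability T R) (D : set T).
Hypotheses (mD : measurable D) (muD : mu D = 1%E).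
Local Open Scope ereal_scope.

Lemma integral_cst1 (r : R) : \int[mu]_(t in D) (cst r%:E) t = r%:E.
Proof. by rewrite integral_cst// -[RHS]mule1 -muD. Qed.

Section Shift.
Variables (f : T -> \bar R) (K : R).
Hypotheses (mf : measurable_fun D f) (fK : forall t, D t -> (- K)%:E <= f t).

Lemma shift_ge0 t : D t -> 0 <= f t + K%:E.
Proof.
move=> /fK; case: (f t) => [r| |]//; last by move=> _; rewrite addye// leey.
by rewrite -EFinD !lee_fin lerNl => h; rewrite -lerBlDr sub0r lerNl.
Qed.

Lemma measurable_shift : measurable_fun D (fun t => f t + K%:E).
Proof. by apply: emeasurable_funD. Qed.

Lemma integrable_of_shift : \int[mu]_(t in D) (f t + K%:E) < +oo -> mu.-integrable D f.
Proof.
move=> h; have intS : mu.-integrable D (fun t => f t + K%:E).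
  apply/integrableP; split; first exact: measurable_shift.
  by under eq_integral => t /set_mem Dt do rewrite gee0_abs ?shift_ge0//.
have := integrableB mD intS (finite_measure_integrable_cst mu K mD).
by apply: eq_integrable => // t _; rewrite /= addeK.
Qed.

(** The integral of a function bounded below by -K is additive with respect to the
    constant K even when it is +oo; this gives access to the results on nonnegative
    functions. *)
Lemma integral_shift : \int[mu]_(t in D) (f t + K%:E) = \int[mu]_(t in D) f t + K%:E.
Proof.
have [h|] := ltP (\int[mu]_(t in D) (f t + K%:E)) +oo.
  rewrite integralD//; first by rewrite integral_cst1.
    exact: integrable_of_shift.
  exact: finite_measure_integrable_cst.
rewrite leye_eq => /eqP h; rewrite h integralE.
have mfp : measurable_fun D f^\+ by exact: measurable_funepos.
have mfn : measurable_fun D f^\- by exact: measurable_funeneg.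
have fn : \int[mu]_(t in D) f^\- t <= `|K|%:E.
  rewrite -(integral_cst1 `|K|); apply: ge0_le_integral => //.
  move=> t Dt; rewrite funenegE ge_max leeNl -EFinN; apply/andP; split; last by rewrite lee_fin.
  by apply: le_trans (fK Dt); rewrite lee_fin lerN2 ler_norm.
have fn0 : 0 <= \int[mu]_(t in D) f^\- t by exact: integral_ge0.
have fp : \int[mu]_(t in D) f^\+ t = +oo.
  have : +oo <= \int[mu]_(t in D) (f^\+ t + `|K|%:E).
    rewrite -h; apply: ge0_le_integral => //.
    - by move=> t; exact: shift_ge0.
    - exact: measurable_shift.
    - by apply: emeasurable_funD.
    by move=> t Dt; apply: leeD; [rewrite funeposE le_max lexx|rewrite lee_fin ler_norm].
  rewrite ge0_integralD// integral_cst1 leye_eq => /eqP.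
  by case: (\int[mu]_(t in D) f^\+ t).
rewrite fp; move: fn fn0; case: (\int[mu]_(t in D) f^\- t) => [r| |]//.
Qed.

Lemma integral_lower : (- K)%:E <= \int[mu]_(t in D) f t.
Proof.
have : 0 <= \int[mu]_(t in D) (f t + K%:E) by apply: integral_ge0 => t; exact: shift_ge0.
by rewrite integral_shift -leeBlDr// sub0e -EFinN.
Qed.

Lemma integrable_of_lty : \int[mu]_(t in D) f t < +oo -> mu.-integrable D f.
Proof.
move=> h; apply: integrable_of_shift; rewrite integral_shift.
by rewrite lte_add_pinfty// ltry.
Qed.

Lemma integral_upper (B : R) : (forall t, D t -> f t <= B%:E) ->
  \int[mu]_(t in D) f t <= B%:E.
Proof.
move=> fB; have : \int[mu]_(t in D) (f t + K%:E) <= \int[mu]_(t in D) (cst (B + K)%:E) t.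
  apply: ge0_le_integral => //.
  - by move=> t; exact: shift_ge0.
  - exact: measurable_shift.
  - by move=> t Dt; rewrite EFinD leeD2r// fB.
by rewrite integral_shift integral_cst1 EFinD leeD2rE.
Qed.

End Shift.

Lemma integral_convex_le (f f1 f2 : T -> \bar R) (K l r s : R) : (0 < l < 1)%R ->
  measurable_fun D f -> measurable_fun D f1 -> measurable_fun D f2 ->
  (forall t, D t -> (- K)%:E <= f t) -> (forall t, D t -> (- K)%:E <= f1 t) ->
  (forall t, D t -> (- K)%:E <= f2 t) ->
  (forall t, D t -> f t <= l%:E * f1 t + (1 - l)%:E * f2 t) ->
  \int[mu]_(t in D) f1 t = r%:E -> \int[mu]_(t in D) f2 t = s%:E ->
  \int[mu]_(t in D) f t <= (l * r + (1 - l) * s)%:E.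
Proof.
move=> /andP[l0 l1] mf mf1 mf2 fK f1K f2K hf e1 e2.
have l1' : (0 < 1 - l)%R by rewrite subr_gt0.
have g0 t : D t -> 0 <= f t + K%:E by exact: shift_ge0.
have g10 t : D t -> 0 <= f1 t + K%:E by exact: shift_ge0.
have g20 t : D t -> 0 <= f2 t + K%:E by exact: shift_ge0.
have mg := measurable_shift K mf; have mg1 := measurable_shift K mf1.
have mg2 := measurable_shift K mf2.
have : \int[mu]_(t in D) (f t + K%:E) <=
    \int[mu]_(t in D) (l%:E * (f1 t + K%:E) + (1 - l)%:E * (f2 t + K%:E)).
  apply: ge0_le_integral => //.
  - by apply: emeasurable_funD; apply: measurable_funeM.
  - move=> t Dt; apply: (le_trans (leeD2r _ (hf t Dt))).
    have := f1K t Dt; have := f2K t Dt.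
    case: (f1 t) => [a| |]//; case: (f2 t) => [b| |]// _ _.
    + by rewrite -!(EFinD, EFinM) lee_fin; lra.
    + by rewrite !(addye, gt0_muley, addey) ?lte_fin// leey.
    + by rewrite !(addye, gt0_muley, addey) ?lte_fin// leey.
    + by rewrite !(addye, gt0_muley, addey) ?lte_fin// leey.
have -> : \int[mu]_(t in D) (l%:E * (f1 t + K%:E) + (1 - l)%:E * (f2 t + K%:E)) =
    \int[mu]_(t in D) (l%:E * (f1 t + K%:E)) + \int[mu]_(t in D) ((1 - l)%:E * (f2 t + K%:E)).
  apply: ge0_integralD => //; try exact: measurable_funeM.
  - by move=> t Dt; apply: mule_ge0; [rewrite lee_fin ltW|exact: g10].
  - by move=> t Dt; apply: mule_ge0; [rewrite lee_fin ltW|exact: g20].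
have -> : \int[mu]_(t in D) (l%:E * (f1 t + K%:E)) = l%:E * \int[mu]_(t in D) (f1 t + K%:E).
  by apply: ge0_integralZl_EFin => //; exact: ltW.
have -> : \int[mu]_(t in D) ((1 - l)%:E * (f2 t + K%:E)) =
    (1 - l)%:E * \int[mu]_(t in D) (f2 t + K%:E).
  by apply: ge0_integralZl_EFin => //; exact: ltW.
rewrite !integral_shift// e1 e2.
rewrite -!(EFinD, EFinM).
have -> : (l * (r + K) + (1 - l) * (s + K) = (l * r + (1 - l) * s) + K)%R by ring.
by rewrite [(_ + K)%:E]EFinD leeD2rE.
Qed.

(** Fatou's lemma, in the form that yields lower semicontinuity of an integral with
    parameter. *)
Lemma integral_liminf_le (f : T -> \bar R) (f_ : nat -> T -> \bar R) (K a : R) :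
  measurable_fun D f -> (forall j, measurable_fun D (f_ j)) ->
  (forall t, D t -> (- K)%:E <= f t) -> (forall j t, D t -> (- K)%:E <= f_ j t) ->
  (forall t (b : R), D t -> b%:E < f t -> \forall j \near \oo, b%:E < f_ j t) ->
  (forall j, \int[mu]_(t in D) f_ j t <= a%:E) -> \int[mu]_(t in D) f t <= a%:E.
Proof.
move=> mf mf_ fK f_K flow hle.
have einf (u : nat -> \bar R) (b : R) : (\forall j \near \oo, b%:E < u j) -> b%:E <= limn_einf u.
  move=> [N _ hN]; rewrite /limn_einf leeNr.
  apply: (@le_trans _ _ (ereal_sup ((fun j => - u j) @` [set j | (N <= j)%N]))).
    by apply: ereal_inf_lbound; exists [set j | (N <= j)%N] => //; exists N.
  by apply: ge_ereal_sup => _ [j jN <-]; rewrite leeN2 ltW//; exact: hN.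
have einf_le (u : nat -> \bar R) (b : R) : (forall j, u j <= b%:E) -> limn_einf u <= b%:E.
  move=> hu; apply: le_trans (limn_einf_sup u) _.
  apply: (@le_trans _ _ (ereal_sup (u @` [set: nat]))).
    by apply: ereal_inf_lbound; exists [set: nat] => //; exact: filterT.
  by apply: ge_ereal_sup => _ [j _ <-].
have mS j := measurable_shift K (mf_ j).
have S0 j t (Dt : D t) : 0 <= f_ j t + K%:E := shift_ge0 (f_K j) Dt.
have : \int[mu]_(t in D) (f t + K%:E) <= (a + K)%:E.
  apply: (@le_trans _ _ (limn_einf (fun j => \int[mu]_(t in D) (f_ j t + K%:E)))); last first.
    apply: einf_le => j; rewrite (integral_shift (mf_ j) (f_K j)).
    exact: leeD2r _ (hle j).
  apply: le_trans (fatou mu mD mS S0).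
  apply: ge0_le_integral => //.
  - by move=> t; exact: shift_ge0.
  - exact: measurable_shift.
  - rewrite /limn_einf; apply: measurableT_comp; first exact: oppe_measurable.
    apply: measurable_fun_limn_esup => j; apply: measurableT_comp => //.
  move=> t Dt; rewrite leNgt; apply/negP => /ereal_between[b [h1 h2]].
  have : b%:E <= limn_einf (fun j => f_ j t + K%:E).
    apply: einf; have := flow t (b - K)%R Dt.
    rewrite EFinB lteBlDr// => /(_ h2); apply: filterS => j.
    by rewrite lteBlDr.
  by rewrite leNgt h1.
by rewrite integral_shift// EFinD leeD2rE.
Qed.

End IntegralsBoundedBelow.

(** * Conjugates of the symmetrized function *)

Section ConjugateOfSymmetrization.
Variables (R : realType) (n : nat).
Local Notation V := 'cV[R]_n.
Local Open Scope ereal_scope.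

Lemma lsc_of_sequences (g : V -> \bar R) :
  (forall (x : V) (x_ : nat -> V) (a : R), x_ j @[j --> \oo] --> x ->
     (forall j, g (x_ j) <= a%:E) -> g x <= a%:E) -> lower_semicontinuous g.
Proof.
move=> h; apply: near_lsc => x a ax; apply: contrapT => nx.
have e0 (j : nat) : (0 < j.+1%:R^-1 :> R)%R by rewrite invr_gt0.
have /choice[x_ hx_] : forall j : nat, exists y : V, ball x j.+1%:R^-1%R y /\ g y <= a%:E.
  move=> j; apply: contrapT => hj; apply: nx; apply/nbhs_ballP.
  exists (j.+1%:R^-1)%R => //= y xy; rewrite ltNge; apply/negP => ya.
  by apply: hj; exists y.
have : g x <= a%:E.
  apply: (h x x_ a) => [|j]; last exact: (hx_ j).2.
  apply/cvg_ballP => e ep.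
  have [N _ hN] := near_infty_natSinv_lt (PosNum ep).
  exists N => // j /= Nj; apply: le_ball (hx_ j).1.
  exact: ltW (hN j Nj).
by rewrite leNgt ax.
Qed.

Section Average.
Variables (mu : probability (borel_mx R n) R) (psi : V -> \bar R).
Hypotheses (muD : mu (@rotation_group R n) = 1) (cpsi : Conv_c psi).

Let D : set (borel_mx R n) := @rotation_group R n.
Let h := legendre psi.
Let hrot (x : V) (t : borel_mx R n) : \bar R := h (invmx (t : 'M[R]_n) *m x)%R.

(** The conjugate that the symmetrized function is required to have. *)
Definition avg_legendre (x : V) : \bar R :=
  \int[mu]_(t in @rotation_group R n) legendre psi (invmx (t : 'M[R]_n) *m x)%R.

Let mD : measurable D. Proof. exact: measurable_rotation_group. Qed.

Let mhrot x : measurable_fun D (hrot x).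
Proof. by apply: measurable_fun_rotation; exact: legendre_lsc. Qed.

Let hrot_lower : exists C E : R, (0 <= C)%R /\
  forall x t, D t -> (- (C * enorm x + E))%:E <= hrot x t.
Proof.
have [C [E [C0 hl]]] := legendre_lower cpsi; exists C, E; split=> // x t Dt.
by have := hl (invmx t *m x)%R; rewrite enorm_orthogonal ?opprD//; exact: Dt.1.
Qed.

Lemma avg_legendre_lower : exists C E : R, (0 <= C)%R /\
  forall x, (- (C * enorm x) - E)%:E <= avg_legendre x.
Proof.
have [C [E [C0 hl]]] := hrot_lower; exists C, E; split=> // x.
by rewrite -opprD; apply: (integral_lower mD muD (mhrot x)) => t; exact: hl.
Qed.

Lemma avg_legendre_neqNy x : avg_legendre x != -oo.
Proof.
have [C [E [_ hl]]] := avg_legendre_lower.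
by rewrite -ltNye; apply: lt_le_trans (hl x); rewrite ltNyr.
Qed.

Lemma avg_legendre_upper x (B : R) : (forall z, enorm z = enorm x -> h z <= B%:E) ->
  avg_legendre x <= B%:E.
Proof.
have [C [E [C0 hl]]] := hrot_lower => hB.
apply: (integral_upper mD muD (mhrot x) (hl x)) => t Dt.
by apply: hB; rewrite enorm_orthogonal//; exact: Dt.1.
Qed.

Lemma avg_legendre_near0 : exists c d : R, (0 < c)%R /\
  forall y, (enorm y <= c)%R -> avg_legendre y <= d%:E.
Proof.
have [c [d [c0 hd]]] := legendre_near0 cpsi; exists c, d; split=> // y yc.
by apply: avg_legendre_upper => z zy; apply: hd; rewrite zy.
Qed.

Lemma avg_legendre_integrable y : avg_legendre y < +oo -> mu.-integrable D (hrot y).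
Proof.
have [C [E [C0 hl]]] := hrot_lower.
exact: (integrable_of_lty mD muD (mhrot y) (hl y)).
Qed.

Lemma avg_legendre_convex : convex_ereal avg_legendre.
Proof.
apply: convex_ereal_fin => [x|x y l r s l01 xr ys]; first exact: avg_legendre_neqNy.
have [C [E [C0 hl]]] := hrot_lower.
pose z := (l *: x + (1 - l) *: y)%R.
pose K := (C * (enorm x + enorm y + enorm z) + E)%R.
have KP w : (enorm w <= enorm x + enorm y + enorm z)%R ->
    forall t, D t -> (- K)%:E <= hrot w t.
  move=> hw t Dt; apply: le_trans (hl w t Dt); rewrite lee_fin lerN2 lerD2r.
  exact: ler_wpM2l.
have x0 := enorm_ge0 x; have y0 := enorm_ge0 y; have z0 := enorm_ge0 z.
apply: (integral_convex_le mD muD (K := K) l01 (mhrot z) (mhrot x) (mhrot y) _ _ _ _ xr ys).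
- by apply: KP; lra.
- by apply: KP; lra.
- by apply: KP; lra.
move=> t Dt; rewrite /hrot /z mulmxDr -!scalemxAr.
by apply: legendre_convex => //; exact: Conv_c_proper.
Qed.

(** Along a convergent sequence the integrands have a common lower bound, since the lower
    bound of h depends on the norm only. *)
Lemma avg_legendre_lsc : lower_semicontinuous avg_legendre.
Proof.
apply: lsc_of_sequences => x x_ a xx_ hle.
have [C [E [C0 hl]]] := hrot_lower.
have [M hM] : exists M : R, (enorm x <= M)%R /\ forall j, (enorm (x_ j) <= M)%R.
  have [N _ hN] := xx_ _ (@nbhs_enorm R n x 1%R ltr01).
  exists (enorm x + 1 + \sum_(j < N) enorm (x_ j))%R; split.
    by rewrite -addrA lerDl addr_ge0// sumr_ge0// => i _; exact: enorm_ge0.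
  move=> j; have [jN|Nj] := ltnP j N.
    rewrite (bigD1 (Ordinal jN))//= addrCA lerDl !addr_ge0 ?enorm_ge0//.
    by apply: sumr_ge0 => i _; exact: enorm_ge0.
  have := hN j Nj; rewrite /= => /ltW h1.
  have -> : x_ j = (x_ j - x + x)%R by rewrite subrK.
  apply: le_trans (ler_enormD _ _) _; rewrite addrC.
  rewrite -addrA lerD2l -[leLHS]addr0 lerD// sumr_ge0// => i _; exact: enorm_ge0.
pose K := (C * M + E)%R.
have KP w : (enorm w <= M)%R -> forall t, D t -> (- K)%:E <= hrot w t.
  move=> hw t Dt; apply: le_trans (hl w t Dt); rewrite lee_fin lerN2 lerD2r.
  exact: ler_wpM2l.
apply: (integral_liminf_le mD muD (K := K) (f_ := fun j => hrot (x_ j)) (mhrot x)) => //.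
- exact: KP hM.1.
- by move=> j; exact: KP (hM.2 j).
move=> t b Dt bt.
have ct : continuous (fun y : V => (invmx (t : 'M[R]_n) *m y)%R).
  apply: continuous_entries => i j.
  rewrite (_ : (fun _ => _) = (fun y : V => \sum_k invmx (t : 'M[R]_n) i k * y k j)%R).
    apply: continuous_sumr => k y.
    exact: (cvgMl_tmp (@coord_continuous R n 1 k j y)).
  by apply/funext => y; rewrite mxE.
exact: xx_ _ (ct _ _ (lsc_near (@legendre_lsc _ _ psi) bt)).
Qed.

End Average.

(** An upper bound d of g on the ball of radius c gives the lower bound c |x| - d of its
    conjugate; properness comes from biconjugation. *)
Lemma Conv_c_legendre (g : V -> \bar R) (C E c d : R) :
  (forall x, g x != -oo) -> convex_ereal g -> lower_semicontinuous g ->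
  (0 <= C)%R -> (forall x, (- (C * enorm x) - E)%:E <= g x) ->
  (0 < c)%R -> (forall y, (enorm y <= c)%R -> g y <= d%:E) ->
  Conv_c (legendre g).
Proof.
move=> gN gc gl C0 glow c0 gup.
have g0 : g 0%R < +oo.
  by apply: le_lt_trans (gup 0%R _) _; rewrite ?ltry// enorm0 ltW.
have gp : exists y, g y != +oo by exists 0%R; rewrite -ltey.
split.
- by move=> x; exact: legendre_neqNy.
- apply: contrapT => h; have := gN 0%R.
  rewrite -(fenchel_moreau gN gc gl C0 glow) -ltNye ltNge; apply/negP; apply/negPn.
  apply: legendre_le => x; have -> : legendre g x = +oo.
    by apply: contrapT => /eqP xoo; apply: h; exists x.
  by rewrite addeNy.
- exact: legendre_convex.
- exact: legendre_lsc.
- move=> A; exists (Num.max 1 ((A + d) / c))%R => x; rewrite ge_max => /andP[x1 xA].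
  have x0 : (0 < enorm x)%R by exact: lt_le_trans x1.
  have yc : enorm ((c / enorm x) *: x) = c.
    by rewrite enormZ ger0_norm ?divfK ?gt_eqF// divr_ge0// ltW.
  have yc' : (enorm ((c / enorm x) *: x) <= c)%R by rewrite yc.
  apply: le_trans (legendre_ub g x ((c / enorm x) *: x)%R).
  apply: (@le_trans _ _ ((dotv x ((c / enorm x) *: x)%R)%:E - d%:E)); last first.
    by rewrite leeD2l// leeN2 gup.
  rewrite -EFinB lee_fin dotvZr -sqr_enorm.
  have -> : (c / enorm x * enorm x ^+ 2 = c * enorm x)%R.
    by field; rewrite gt_eqF.
  by move: xA; rewrite ler_pdivrMr// mulrC; lra.
Qed.

(** The conjugate of the averaged conjugate is the required function, by biconjugation. *)
Lemma rot_sym_spec (mu : probability (borel_mx R n) R) (psi : V -> \bar R) :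
  n != 1%N -> mu (@rotation_group R n) = 1 -> Conv_c psi ->
  Conv_c (rot_sym mu psi) /\ forall x, legendre (rot_sym mu psi) x = avg_legendre mu psi x.
Proof.
move=> n1 muD cpsi; rewrite /rot_sym (negbTE n1).
have [C [E [C0 low]]] := avg_legendre_lower muD cpsi.
have [c [d [c0 up]]] := avg_legendre_near0 muD cpsi.
have gN := avg_legendre_neqNy muD cpsi.
have gc := avg_legendre_convex muD cpsi.
have gl := avg_legendre_lsc muD cpsi.
set P := (X in xget _ X).
suff : P (legendre (avg_legendre mu psi)) by move=> /(xgetI (fun=> +oo)).
split; first exact: Conv_c_legendre gN gc gl C0 low c0 up.
by move=> x; rewrite (fenchel_moreau gN gc gl C0 low).
Qed.

Lemma Conv_c_opp (psi : V -> \bar R) : Conv_c psi -> Conv_c (fun y => psi (- y)%R).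
Proof.
move=> cpsi; split.
- by move=> x; exact: Conv_c_ninfty.
- by have [x xoo] := Conv_c_proper cpsi; exists (- x)%R; rewrite opprK.
- move=> x y t t01; rewrite opprD -!scalerN; exact: Conv_c_convex.
- apply: (@lsc_comp R n n psi (fun y => - y)%R); first exact: Conv_c_lsc.
  exact: oppr_continuous.
- by move=> A; have [M MA] := Conv_c_coercive cpsi A; exists M => x xM; apply: MA; rewrite enormN.
Qed.

(** In dimension 1 the weights are written 1/2 and 1 - 1/2, the form in which
    log-concavity is applied. *)
Lemma rot_sym1_spec (mu : probability (borel_mx R n) R) (psi : V -> \bar R) :
  n = 1%N -> Conv_c psi ->
  Conv_c (rot_sym mu psi) /\ forall y, legendre (rot_sym mu psi) y =
    (2^-1)%:E * legendre psi y + (1 - 2^-1)%:E * legendre psi (- y)%R.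
Proof.
move=> n1 cpsi.
have copp := Conv_c_opp cpsi.
have rotE : rot_sym mu psi = epi_scale 2^-1 (inf_conv psi (fun y => psi (- y)%R)).
  by rewrite /rot_sym (introT eqP n1); apply/funext => x; rewrite /epi_scale invrK.
have crot : Conv_c (rot_sym mu psi).
  by rewrite rotE; apply: Conv_c_epi_scale; rewrite ?invr_gt0//; exact: Conv_c_inf_conv.
split=> // y.
have half : (1 - 2^-1 = 2^-1 :> R)%R by lra.
rewrite half.
have hN z := legendre_neqNy z (Conv_c_proper cpsi).
have half0 : (0 < 2^-1 :> R)%R by rewrite invr_gt0.
apply/eqP; rewrite eq_le; apply/andP; split.
  apply: legendre_le => x; rewrite rotE /epi_scale invrK.
  have [z ->] := inf_conv_attained cpsi copp (2 *: x)%R.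
  have h1 := legendre_ub psi y (2 *: x - z)%R.
  have h2 := legendre_ub psi (- y)%R (- z)%R.
  have dE : dotv y x = (2^-1 * (dotv y (2 *: x - z) + dotv (- y) (- z)))%R.
    by rewrite dotvDr !dotvNr dotvNl dotvZr; field.
  apply: le_trans (leeD (lee_wpmul2l _ h1) (lee_wpmul2l _ h2)); rewrite ?lee_fin ?(ltW half0)//.
  have := Conv_c_ninfty cpsi (2 *: x - z)%R; have := Conv_c_ninfty cpsi (- z)%R.
  case: (psi (2 *: x - z)%R) => [p| |]//; case: (psi (- z)%R) => [q| |]// _ _.
  - by rewrite -!(EFinM, EFinB, EFinD) lee_fin dE; lra.
  - by rewrite addey// gt0_muley ?lte_fin//= leNye.
  - by rewrite addye// gt0_muley ?lte_fin//= leNye.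
  - by rewrite addye// gt0_muley ?lte_fin//= leNye.
rewrite leNgt; apply/negP => hlt.
have := legendre_neqNy y (Conv_c_proper crot).
case eL : (legendre (rot_sym mu psi) y) => [r| |]// _; last by move: hlt; rewrite eL ltNge leey.
move: hlt; rewrite eL => /lte_split_add[||b [c [hb hc rbc]]]; try exact: scale_neqNy.
move: hb hc; rewrite !(muleC (2^-1)%:E) -!lte_pdivrMr// -!EFinM invrK.
move=> /ereal_sup_gt[_ [u _ <-] hu] /ereal_sup_gt[_ [w _ <-] hw].
have := Conv_c_ninfty cpsi u; have := Conv_c_ninfty cpsi w.
case eu : (psi u) hu => [p| |]//; case ew : (psi w) hw => [q| |]//.
rewrite -!EFinB !lte_fin dotvNl => hw hu _ _.
have rot_le : rot_sym mu psi (2^-1 *: (u - w))%R <= (2^-1 * (p + q))%:E.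
  rewrite rotE /epi_scale invrK EFinM lee_wpmul2l ?lee_fin ?(ltW half0)//.
  apply: ereal_inf_lbound; exists (- w)%R => //.
  by rewrite scalerA mulfV// scale1r opprK subrK eu ew.
have := legendre_ub (rot_sym mu psi) y (2^-1 *: (u - w))%R; rewrite eL.
have /le_trans h : (dotv y (2^-1 *: (u - w)))%:E - (2^-1 * (p + q))%:E <=
    (dotv y (2^-1 *: (u - w)))%:E - rot_sym mu psi (2^-1 *: (u - w))%R.
  by rewrite leeD2l// leeN2.
move=> /h; rewrite -EFinB lee_fin dotvZr dotvDr dotvNr; lra.
Qed.

End ConjugateOfSymmetrization.

(** * The symmetrization inequality *)

Section SymmetrizationInequality.
Variables (R : realType) (n : nat).
Local Notation V := 'cV[R]_n.
Local Open Scope ereal_scope.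
Hypothesis n_gt0 : (0 < n)%N.

Lemma sym_group_orthogonal (t : 'M[R]_n) : sym_group t -> orthogonal_group t.
Proof. by rewrite /sym_group; case: ifP => // _ []. Qed.

Lemma rotation_group_mul (s t : 'M[R]_n) :
  rotation_group s -> rotation_group t -> rotation_group (s *m t)%R.
Proof.
move=> [os ds] [ot dt]; split; last by rewrite det_mulmx ds dt mulr1.
by rewrite /orthogonal_group /= trmx_mul mulmxA -(mulmxA t^T%R) os mulmx1.
Qed.

Section AdmissibleFamily.
Variables (psi : V -> \bar R) (psi_conv : Conv_c psi)
  (YY : set (set V)) (YY_adm : YY `<=` admissible psi).

Lemma legendre_rotate_lty (t : 'M[R]_n) (y : V) : sym_group t ->
  interior (Defs.radius_ball psi) y -> legendre psi (invmx t *m y)%R < +oo.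
Proof.
move=> /sym_group_orthogonal ot /(legendre_bounded_in_radius psi_conv)[B hB].
by apply: le_lt_trans (hB _ _) _; rewrite ?ltry// enorm_orthogonal.
Qed.

Section FiniteConjugate.
Variables (phi : V -> \bar R) (phi_conv : Conv_c phi).
Hypothesis phi_fin : forall (t : 'M[R]_n) (y : V), sym_group t ->
  interior (Defs.radius_ball psi) y -> legendre phi (invmx t *m y)%R < +oo.

Lemma Conv_c_sym_linearization (t : 'M[R]_n) (Y : set V) : sym_group t -> YY Y ->
  Conv_c (outer_lin (rotate t phi) Y).
Proof.
move=> st /YY_adm[Yo [YoY Yopos Yoint]].
apply: (Conv_c_outer_lin_rotate (sym_group_orthogonal st) n_gt0 phi_conv YoY).
  exact: pos_hull_pos_spanning.
by move=> y /Yoint; exact: phi_fin.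
Qed.

Lemma Fstar_well_defined_exp_neg : Fstar_well_defined (exp_neg phi) YY.
Proof.
split; first exact: LC_c_exp_neg.
move=> _ [t st [Y YYY <-]]; rewrite exp_negK.
exact/LC_c_exp_neg/Conv_c_sym_linearization.
Qed.

End FiniteConjugate.

Section Functional.
Variable (F : (V -> \bar R) -> \bar R).
Hypotheses (F_val : nonneg_valued F) (F_usc : hypo_usc F)
  (F_lc : log_concave F) (F_mono : monotone_increasing F).
Let c := Fstar F (exp_neg psi) YY.

Lemma Fstar_le_linearization (t : 'M[R]_n) (Y : set V) : sym_group t -> YY Y ->
  c <= F (exp_neg (outer_lin (rotate t psi) Y)).
Proof.
move=> st YYY; apply: ereal_inf_lbound.
exists (exp_neg (outer_lin (rotate t psi) Y)) => //.
by exists t => //; exists Y => //; rewrite exp_negK.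
Qed.

(** The rotated copies that enter the mean are those of t and - t. *)
Lemma symmetrization_inequality_dim1 (mu : probability (borel_mx R n) R)
    (t : 'M[R]_n) (Y : set V) : n = 1%N -> sym_group t -> YY Y ->
  Conv_c (outer_lin (rotate t (rot_sym mu psi)) Y) ->
  c <= F (exp_neg (outer_lin (rotate t (rot_sym mu psi)) Y)).
Proof.
move=> n1 st YYY crot.
have [cr Lr] := rot_sym1_spec mu n1 psi_conv.
have ot := sym_group_orthogonal st.
have NT : ((- t)^T = - t^T)%R by apply/matrixP => i j; rewrite !mxE.
have oNt : orthogonal_group (- t)%R.
  by rewrite /orthogonal_group /= NT mulNmx mulmxN opprK.
have sNt : sym_group (- t)%R by rewrite /sym_group (introT eqP n1).
have c1 := Conv_c_sym_linearization psi_conv legendre_rotate_lty st YYY.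
have c2 := Conv_c_sym_linearization psi_conv legendre_rotate_lty sNt YYY.
have h1 := Fstar_le_linearization st YYY.
have h2 := Fstar_le_linearization sNt YYY.
move: crot c1 c2 h1 h2; rewrite !outer_lin_rotate// => crot c1 c2 h1 h2.
have LN z := legendre_neqNy z (Conv_c_proper psi_conv).
apply: (superlevel_env_mean F_val F_lc F_mono (l := 2^-1%R) _ _ _ _ c1 c2 crot h1 h2).
- by rewrite invr_gt0 ltr0n invf_lt1 ?ltr1n ?ltr0n.
- by move=> y _; exact: LN.
- by move=> y _; exact: LN.
move=> y _; rewrite Lr (orthogonal_invmx oNt) (orthogonal_invmx ot) NT mulNmx.
exact: lexx.
Qed.

(** The mean over rotations s of the offsets for t s is the offset for the symmetrized
    function rotated by t. *)
Lemma symmetrization_inequality_haar (mu : probability (borel_mx R n) R)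
    (t : 'M[R]_n) (Y : set V) : n != 1%N -> mu (@rotation_group R n) = 1 ->
  sym_group t -> YY Y ->
  Conv_c (outer_lin (rotate t (rot_sym mu psi)) Y) ->
  c <= F (exp_neg (outer_lin (rotate t (rot_sym mu psi)) Y)).
Proof.
move=> n1 muD st YYY crot.
have [cr Lr] := rot_sym_spec n1 muD psi_conv.
have ot := sym_group_orthogonal st.
have rt : rotation_group t by move: st; rewrite /sym_group (negbTE n1).
have [Yo [YoY Yopos Yoint]] := YY_adm YYY.
have [s [sYo ss]] := pos_spanning_finite (pos_hull_pos_spanning Yopos).
have outE : outer_lin (rotate t (rot_sym mu psi)) Y =
    env Y id (fun y => avg_legendre mu psi (invmx t *m y)%R).
  by rewrite outer_lin_rotate//; congr env; apply/funext => y; rewrite Lr.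
move: crot; rewrite outE => crot.
have mD := @measurable_rotation_group R n.
apply: (superlevel_of_finite F_usc n_gt0 _ ss) => //.
- by move=> y /sYo; exact: YoY.
- move=> y /sYo/Yoint/(legendre_bounded_in_radius psi_conv)[B hB].
  apply: (@le_lt_trans _ _ B%:E); last by rewrite ltry.
  apply: (avg_legendre_upper muD psi_conv) => z; rewrite enorm_orthogonal//.
  exact: hB.
- by move=> y _; exact: avg_legendre_neqNy.
move=> L LY sL.
have intG y : y \in L -> mu.-integrable (@rotation_group R n : set (borel_mx R n))
    (fun s : borel_mx R n => legendre psi (invmx (s : 'M[R]_n) *m (invmx t *m y))%R).
  by move=> /LY[_ yfin]; exact: avg_legendre_integrable.
apply: (superlevel_finite_mean n_gt0 F_val F_usc F_lc F_mono sL mD muD intG) => r Dr Gfin.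
have rtr : rotation_group (t *m (r : 'M[R]_n))%R by exact: rotation_group_mul.
have str : sym_group (t *m (r : 'M[R]_n))%R by rewrite /sym_group (negbTE n1).
have cY := Conv_c_sym_linearization psi_conv legendre_rotate_lty str YYY.
have envLY x : env [set` L] id
      (fun y => legendre psi (invmx (r : 'M[R]_n) *m (invmx t *m y))%R) x <=
    outer_lin (rotate (t *m (r : 'M[R]_n)) psi) Y x.
  rewrite (outer_lin_rotate rtr.1)//.
  have -> : (fun y => legendre psi (invmx (t *m (r : 'M[R]_n)) *m y)%R) =
            (fun y => legendre psi (invmx (r : 'M[R]_n) *m (invmx t *m y))%R).
    apply/funext => y.
    by rewrite (orthogonal_invmx rtr.1) trmx_mul -(orthogonal_invmx Dr.1)
      -(orthogonal_invmx ot) mulmxA.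
  by apply: env_sub => y /= /LY[].
apply: (superlevel_mono F_mono _ cY envLY); last exact: Fstar_le_linearization.
apply: env_Conv_c => //.
  apply: pos_spanningS sL => y /= yL; exists y => //; split=> //.
  by rewrite ltey_eq Gfin.
have [x xoo] := Conv_c_proper cY; exists x.
by rewrite -ltey (le_lt_trans (envLY x))// ltey.
Qed.

End Functional.
End AdmissibleFamily.
End SymmetrizationInequality.

Local Open Scope ereal_scope.

Theorem theorem8p3 (R : realType) (n : nat) (n_gt0 : (0 < n)%N)
  (mu : probability (borel_mx R n) R) (mu_haar : is_haar mu)
  (F : ('cV[R]_n -> \bar R) -> \bar R)
  (F_val : nonneg_valued F) (F_usc : hypo_usc F)
  (F_lc : log_concave F) (F_mono : monotone_increasing F)
  (psi : 'cV[R]_n -> \bar R) (psi_conv : Conv_c psi)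
  (YY : set (set 'cV[R]_n)) (YY_adm : YY `<=` admissible psi) :
  [/\ Fstar_well_defined (exp_neg psi) YY,
      Fstar_well_defined (exp_neg (rot_sym mu psi)) YY &
      Fstar F (exp_neg psi) YY <= Fstar F (exp_neg (rot_sym mu psi)) YY].
Proof.
have muD := mu_haar.1.
have [crot rot_fin] : Conv_c (rot_sym mu psi) /\ forall (t : 'M[R]_n) y, sym_group t ->
    interior (Defs.radius_ball psi) y -> legendre (rot_sym mu psi) (invmx t *m y)%R < +oo.
  have [n1|n1] := eqVneq n 1%N.
    have [cr Lr] := rot_sym1_spec mu n1 psi_conv; split=> // t y st yint.
    have [B hB] := legendre_bounded_in_radius psi_conv yint.
    have yt : enorm (invmx t *m y) = enorm y.
      by rewrite enorm_orthogonal//; exact: sym_group_orthogonal.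
    rewrite Lr; apply: lte_add_pinfty; rewrite lte_mul_pinfty ?lee_fin//.
    - by apply: le_lt_trans (hB _ yt) _; rewrite ltry.
    - by rewrite subr_ge0 invf_le1 ?ler1n.
    - by apply: le_lt_trans (hB _ _) _; rewrite ?ltry// enormN.
  have [cr Lr] := rot_sym_spec n1 muD psi_conv; split=> // t y st yint.
  have [B hB] := legendre_bounded_in_radius psi_conv yint.
  rewrite Lr; apply: (@le_lt_trans _ _ B%:E); last by rewrite ltry.
  apply: (avg_legendre_upper muD psi_conv) => z; rewrite enorm_orthogonal; first exact: hB.
  exact: sym_group_orthogonal.
have psi_fin := legendre_rotate_lty psi_conv.
split.
- exact: (Fstar_well_defined_exp_neg n_gt0 YY_adm psi_conv psi_fin).
- exact: (Fstar_well_defined_exp_neg n_gt0 YY_adm crot rot_fin).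
apply: le_ereal_inf_tmp => _ [_ [t st [Y YYY <-]] <-]; rewrite exp_negK.
have cl := Conv_c_sym_linearization n_gt0 YY_adm crot rot_fin st YYY.
have [n1|n1] := eqVneq n 1%N.
  exact: (symmetrization_inequality_dim1 n_gt0 psi_conv YY_adm).
exact: (symmetrization_inequality_haar n_gt0 psi_conv YY_adm).
Qed.
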